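(* Let $\Pi=(\pi_n)_{n\in\mathbb{N}}$ be a sequence of partitions of $\mathbb{R}_{\ge 0}$ with $|\pi_n|\to 0$. Let $X=(X^1,\dots,X^d)\in QV(\Pi;\mathbb{R}^d)$ and $A=(A^1,\dots,A^m)\in FV_{\mathrm{loc}}^m$. Then, for any function $f\in C^{1,2}(\mathbb{R}^m\times\mathbb{R}^d)$ (variables $(a,x)$) and any $t\in\mathbb{R}_{\ge 0}$, the Itô–Föllmer integral $\int_0^t\langle\nabla_x f(A_{s-},X_{s-}),dX_s\rangle$ exists and satisfies \begin{align*} f(A_t,X_t)-f(A_0,X_0) &=\sum_{k=1}^m\int_0^t\frac{\partial f}{\partial a_k}(A_{s-},X_{s-})\,d(A^k)^{\mathrm{c}}_s+\int_0^t\langle\nabla_x f(A_{s-},X_{s-}),dX_s\rangle\\ &\quad+\frac12\sum_{k,l=1}^d\int_0^t\frac{\partial^2 f}{\partial x_k\partial x_l}(A_{s-},X_{s-})\,d[X^k,X^l]^{\mathrm{c}}_s\\ &\quad+\sum_{0<s\le t}\Big\{\Delta f(A_s,X_s)-\sum_{k=1}^d\frac{\partial f}{\partial x_k}(A_{s-},X_{s-})\,\Delta X^k_s\Big\}. \end{align*}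
   Context: Conventions. A càdlàg path is a function on $\mathbb{R}_{\ge 0}$ that is right continuous with finite left limits; $X_{0-}=X_0$, $\Delta X_t=X_t-X_{t-}$ (so $\Delta X_0=0$), and $\Delta f(A_s,X_s)=f(A_s,X_s)-f(A_{s-},X_{s-})$. A partition is $\pi=(t_i)_{i\in\mathbb{N}}$ with $0=t_0<t_1<\cdots\to\infty$, and $|\pi|=\sup_i|t_{i+1}-t_i|$. Quadratic variation. A real càdlàg path $X$ has quadratic variation along $\Pi=(\pi_n)$ if $t\mapsto\sum_{t_i\in\pi_n}(X_{t_{i+1}\wedge t}-X_{t_i\wedge t})^2$ converges pointwise to a càdlàg increasing function $[X,X]$ with $\Delta[X,X]_t=(\Delta X_t)^2$ for all $t\ge0$. An $\mathbb{R}^d$-valued càdlàg path $X$ has quadratic variation along $\Pi$ if $X^i+X^j$ does for all $i,j\in\{1,\dots,d\}$. $QV(\Pi;\mathbb{R}^d)$ is the set of such paths. The covariation is $[X,Y]=\frac12([X+Y,X+Y]-[X,X]-[Y,Y])$. Finite variation. $FV_{\mathrm{loc}}$ is the set of real càdlàg paths of locally finite variation. For $A\in FV_{\mathrm{loc}}$, $A^{\mathrm{d}}_t=\sum_{0<s\le t}\Delta A_s$ and $A^{\mathrm{c}}=A-A^{\mathrm{d}}$ is its continuous part; $\int_0^t f\,dA=\int_{]0,t]}f\,dA$ (Lebesgue–Stieltjes). Itô–Föllmer integral. For càdlàg $\xi$ and $X$ in $\mathbb{R}^d$, $\int_0^t\langle\xi_{s-},dX_s\rangle:=\lim_{n\to\infty}\sum_{t_i\in\pi_n}\langle\xi_{t_i},X_{t_{i+1}\wedge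 t}-X_{t_i\wedge t}\rangle$; it is said to exist if this limit exists and is finite. $C^{1,2}(\mathbb{R}^m\times\mathbb{R}^d)$: real functions $f(a,x)$ once continuously differentiable in $a$ and twice in $x$, with all these derivatives continuous in $(a,x)$ jointly. *)

(* Defs.v *)
From HB Require Import structures.
From mathcomp Require Import all_boot all_order all_algebra.
From mathcomp Require Import all_classical all_reals all_analysis.
Set Implicit Arguments.
Unset Strict Implicit.
Unset Printing Implicit Defensive.
Import Order.TTheory GRing.Theory Num.Theory.
Import numFieldNormedType.Exports.
Local Open Scope classical_set_scope.
Local Open Scope ring_scope.

(* Paths on the half-line [0, +oo[ are represented by functions on the whole
   of R; every notion below depends only on their values on [0, +oo[. *)

Section cadlag_paths.
Context {R : realType} {V : normedModType R}.
Implicit Types (X : R -> V) (t : R).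

Definition cadlag X : Prop :=
  (forall t, 0 <= t -> X s @[s --> t^'+] --> X t) /\
  (forall t, 0 < t -> cvg (X s @[s --> t^'-])).

(* With the convention that the left limit at 0 is the value at 0. *)
Definition left_lim X t : V :=
  if t <= 0 then X 0 else lim (X s @[s --> t^'-]).

Definition jump X t : V := X t - left_lim X t.

End cadlag_paths.

Section partitions.
Context {R : realType}.

Record time_partition := TimePartition {
  time :> nat -> R ;
  time0 : time 0%N = 0 ;
  time_lt : forall i, time i < time i.+1 ;
  time_cvgy : time i @[i --> \oo] --> +oo }.

Definition mesh (p : time_partition) : \bar R :=
  ereal_sup [set `|p i.+1 - p i|%:E | i in [set: nat]].

Definition mesh_vanishes (P : nat -> time_partition) : Prop :=
  mesh (P n) @[n --> \oo] --> 0%E.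

End partitions.
Arguments time_partition : clear implicits.

Section quadratic_variation.
Context {R : realType}.
Variable P : nat -> time_partition R.
Implicit Types X Y : R -> R.

Definition qv_sum X t (n : nat) : R :=
  limn (series (fun i =>
    (X (Num.min (P n i.+1) t) - X (Num.min (P n i) t)) ^+ 2)).

Definition quad_var X : R -> R := fun t => limn (qv_sum X t).

Definition has_quad_var X : Prop :=
  [/\ cadlag X,
      forall t : R, 0 <= t -> cvgn (qv_sum X t),
      cadlag (quad_var X),
      {in `[0, +oo[ &, nondecreasing_fun (quad_var X)} &
      forall t : R, 0 <= t -> jump (quad_var X) t = jump X t ^+ 2].

Definition covar X Y : R -> R :=
  fun t => 2^-1 * (quad_var (X \+ Y) t - quad_var X t - quad_var Y t).

End quadratic_variation.

Definition path_coord {R : realType} {d : nat} (X : R -> 'rV[R]_d) (i : 'I_d)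
  : R -> R := fun t => X t 0 i.

Definition QV {R : realType} (P : nat -> time_partition R) (d : nat)
    (X : R -> 'rV[R]_d) : Prop :=
  cadlag X /\
  forall i j : 'I_d, has_quad_var P (path_coord X i \+ path_coord X j).

Section finite_variation.
Context {R : realType}.
Implicit Types A B F g : R -> R.

Definition FV_loc A : Prop :=
  cadlag A /\ forall T : R, 0 <= T -> bounded_variation 0 T A.

(* The unordered sum of a real family, meaningful when the family is summable
   (absolutely) on D. *)
Definition unordered_sum (D : set R) (u : R -> R) : R :=
  fine (esum D (EFin \o u)^\+ - esum D (EFin \o u)^\-)%E.

Definition disc_part A : R -> R := fun t => unordered_sum `]0, t] (jump A).

Definition cont_part A : R -> R := fun t => A t - disc_part A t.

(* The Lebesgue-Stieltjes measure as a total function of F; it is the zero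
   measure when F is not a cumulative function. *)
Definition ls_measure F : {measure set (measurableTypeR R) -> \bar R} :=
  match pselect ({homo F : x y / x <= y} /\ right_continuous F) with
  | left H => lebesgue_stieltjes_measure
      (HB.pack_for (cumulative R R) F (isCumulative.Build R _ R F H.1 H.2))
  | right _ => mzero
  end.

(* The positive and negative variations of A, so that
   A t = pos_var A t - neg_var A t for t >= 0; extended by constants to t < 0. *)
Definition pos_var A : R -> R := fun t => fine (pos_tv 0 A (Num.max 0 t)).
Definition neg_var A : R -> R := fun t => fine (neg_tv 0 A (Num.max 0 t)).

Definition fv_integrable A g (t : R) : Prop :=
  (ls_measure (pos_var A)).-integrable `]0, t] (EFin \o g) /\
  (ls_measure (neg_var A)).-integrable `]0, t] (EFin \o g).

Definition fv_int A g (t : R) : R :=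
  \int[ls_measure (pos_var A)]_(s in `]0, t]) g s -
  \int[ls_measure (neg_var A)]_(s in `]0, t]) g s.

End finite_variation.

Section ito_follmer.
Context {R : realType} {d : nat}.
Variable P : nat -> time_partition R.
Implicit Types xi X : R -> 'rV[R]_d.

Definition dot (u v : 'rV[R]_d) : R := \sum_(k < d) u 0 k * v 0 k.

Definition if_sum xi X t (n : nat) : R :=
  limn (series (fun i =>
    dot (xi (P n i)) (X (Num.min (P n i.+1) t) - X (Num.min (P n i) t)))).

(* The integral of the left limits of xi against X: the integrand is passed as
   the path xi itself, since the Riemann sums evaluate it at the times of P n. *)
Definition if_int_exists xi X t : Prop := cvgn (if_sum xi X t).
Definition if_int xi X t : R := limn (if_sum xi X t).

End ito_follmer.

Section C12.
Context {R : realType} {m d : nat}.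
Implicit Type f : 'rV[R]_m -> 'rV[R]_d -> R.

Definition partial_a f (k : 'I_m) (a : 'rV[R]_m) (x : 'rV[R]_d) : R :=
  'D_(delta_mx 0 k) (f ^~ x) a.

Definition partial_x f (k : 'I_d) (a : 'rV[R]_m) (x : 'rV[R]_d) : R :=
  'D_(delta_mx 0 k) (f a) x.

Definition partial_xx f (k l : 'I_d) : 'rV[R]_m -> 'rV[R]_d -> R :=
  partial_x (partial_x f l) k.

Definition grad_x f (a : 'rV[R]_m) (x : 'rV[R]_d) : 'rV[R]_d :=
  \row_(k < d) partial_x f k a x.

Definition jointly_continuous f : Prop :=
  continuous (fun p : 'rV[R]_m * 'rV[R]_d => f p.1 p.2).

Definition C12 f : Prop :=
  [/\ forall k a x, derivable (f ^~ x) a (delta_mx 0 k),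
      forall k a x, derivable (f a) x (delta_mx 0 k) &
      forall k l a x, derivable (partial_x f l a) x (delta_mx 0 k)] /\
  [/\ forall k, jointly_continuous (partial_a f k),
      forall k, jointly_continuous (partial_x f k) &
      forall k l, jointly_continuous (partial_xx f k l)].

End C12.

(* Main.v *)
Require Import Defs.
From HB Require Import structures.
From mathcomp Require Import all_boot all_order all_algebra.
From mathcomp Require Import all_classical all_reals all_analysis.
From mathcomp Require Import measurable_realfun ring lra.
Set Implicit Arguments.
Unset Strict Implicit.
Unset Printing Implicit Defensive.
Import Order.TTheory GRing.Theory Num.Theory.
Import numFieldNormedType.Exports.
Local Open Scope classical_set_scope.
Local Open Scope ring_scope.

(** Telescope f (A, X) over the cells of a partition and expand it on each cell by
Taylor's formula at the left end point, to first order in a and to second order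
in x:

  df = f_a dA + f_x dX + 1/2 f_xx dX dX + rem.

The sum of the terms f_x dX is the Riemann sum that defines the integral against
X, so it converges as soon as the three other sums do, and its limit is read off
from theirs.

- The sums of f_a dA and of f_xx dX dX are Riemann sums against a function F of
  finite variation, a coordinate of A or a covariation of X: the weights dA or
  dX dX up to time v sum to about F v - F 0. By [riemann_sum_FV] they tend to the
  integral of the left limits of the coefficient against the continuous part of
  F plus the sum of these left limits times the jumps of F.

- The remainder is small compared with |dA| + |dX|^2, the sum of which is bounded
  by the total variation of A and the quadratic variation of X. So cells on
  which the path oscillates little contribute arbitrarily little, and a cell
  that contains a jump contributes the remainder of this jump: by [sum_rem_cvg]
  the sum tends to the sum over all jumps of their Taylor remainders.

In the total the jump sums of the first item cancel against the terms of first
order in a and of second order in x of the jump remainders, and the jump term of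
the formula is left.

Both limit theorems are proved by the same device, [additive_limit]. The limits
and the error bounds are additive in the time interval, so by compactness it is
enough to compare a sum with its limit on short intervals [u, v[ to the left and
[v, w[ to the right of each time v. There a cadlag path is close to its left
limit at v, respectively to its value at v, and continuity of the derivatives at
this single point gives the estimate. *)

(** * Induction over a compact interval *)

Section interval_induction.
Context {R : realType}.

(** Cousin's lemma: take the supremum of the v for which Q a v holds. The
    one-sided neighbourhoods leave out v itself, because a cadlag path is nearly
    constant on each side of a jump but not across it. *)
Lemma cousin_additive (Q : R -> R -> Prop) (a b : R) : a <= b ->
  (forall u v w, a <= u -> u <= v -> v <= w -> w <= b ->
    Q u v -> Q v w -> Q u w) ->
  (forall v, a <= v -> v <= b -> Q v v) ->
  (forall v, a < v -> v <= b -> \forall u \near v^'-, Q u v) ->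
  (forall v, a <= v -> v < b -> \forall w \near v^'+, Q v w) ->
  Q a b.
Proof.
move=> ab Qadd Qrefl Qleft Qright.
pose E := [set v | a <= v <= b /\ Q a v].
have Ea : E a by split; [rewrite lexx ab | exact: Qrefl].
have ubE : ubound E b by move=> v [/andP[]].
have supE : has_sup E by split; [exists a | exists b].
have as_ : a <= sup E by apply: ub_le_sup => //; exists b.
have sb : sup E <= b by apply: ge_sup => //; exists a.
have Qs : Q a (sup E).
  have [<-|ne] := eqVneq a (sup E); first exact: Qrefl.
  have lt_as : a < sup E by rewrite lt_neqAle ne.
  have [d /= d0 dQ] := Qleft _ lt_as sb.
  have [v [/andP[av vb] Qav] dv] := sup_adherent d0 supE.
  have vs : v <= sup E.
    by apply: ub_le_sup; [exists b | split => //; rewrite av].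
  have [<-//|nvs] := eqVneq v (sup E).
  apply: (Qadd _ v) => //; apply: dQ => /=.
    by rewrite ger0_norm ?subr_ge0// ltrBlDr -ltrBlDl.
  by rewrite lt_neqAle nvs.
have [<-//|ne] := eqVneq (sup E) b.
have lt_sb : sup E < b by rewrite lt_neqAle ne.
have [w [Qw sw wb]] : exists w, [/\ Q (sup E) w, sup E < w & w < b].
  near (sup E)^'+ => w; exists w; split; near: w.
  - exact: Qright.
  - exact: nbhs_right_gt.
  - exact: nbhs_right_lt.
have : w <= sup E.
  apply: ub_le_sup; first by exists b.
  split; first by rewrite (le_trans as_ (ltW sw)) (ltW wb).
  by apply: (Qadd _ (sup E)) => //; exact: ltW.
by rewrite leNgt sw.
Unshelve. all: by end_near. Qed.

(** From local to global estimates. S n v is a sum up to time v, I v its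
    expected limit, and B n v an additive bound for the error. By compactness
    finitely many small intervals suffice: the errors e * (B n w - B n u) add up
    to at most e * C whatever the number of pieces, and for a fixed number of
    pieces the errors eta are arbitrarily small for large n. *)
Lemma additive_limit (S B : nat -> R -> R) (I : R -> R) (C t : R) : 0 <= t ->
  (\forall n \near \oo, B n t - B n 0 <= C) ->
  (forall e, 0 < e -> exists2 G : R -> R -> Prop,
    (forall u w, 0 <= u -> u < w -> w <= t -> G u w ->
      forall eta, 0 < eta -> \forall n \near \oo,
        `|S n w - S n u - (I w - I u)| <= e * (B n w - B n u) + eta) &
    (forall v, 0 < v -> v <= t -> \forall u \near v^'-, G u v) /\
    (forall v, 0 <= v -> v < t -> \forall w \near v^'+, G v w)) ->
  S n t - S n 0 @[n --> \oo] --> I t - I 0.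
Proof.
move=> t0 BC loc.
pose Q e u v := forall eta, 0 < eta -> \forall n \near \oo,
  `|S n v - S n u - (I v - I u)| <= e * (B n v - B n u) + eta.
have QE : forall e, 0 < e -> Q e 0 t.
  move=> e e0; have [G GQ [GL GR]] := loc _ e0.
  apply: cousin_additive => //.
  - move=> u v w _ _ _ _ Quv Qvw eta eta0.
    have eta2 : 0 < eta / 2 by rewrite divr_gt0.
    near=> n.
    have H1 : `|S n v - S n u - (I v - I u)| <= e * (B n v - B n u) + eta / 2.
      by near: n; exact: Quv.
    have H2 : `|S n w - S n v - (I w - I v)| <= e * (B n w - B n v) + eta / 2.
      by near: n; exact: Qvw.
    have -> : S n w - S n u - (I w - I u) =
      (S n v - S n u - (I v - I u)) + (S n w - S n v - (I w - I v)) by ring.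
    by apply: (le_trans (ler_normD _ _)); lra.
  - move=> v _ _ eta eta0; near=> n.
    by rewrite !subrr normr0 mulr0 add0r ltW.
  - move=> v v0 vt; near=> u; apply: GQ => //.
    + by apply/ltW; near: u; exact: nbhs_left_gt.
    + by near: u; exact: GL.
  - move=> v v0 vt; near=> w; apply: GQ => //.
    + by apply/ltW; near: w; exact: nbhs_right_lt.
    + by near: w; exact: GR.
apply/cvgrPdist_le => eps eps0.
have C1 : 0 < 2 * (`|C| + 1) by rewrite mulr_gt0// ltr_wpDl.
have e0 : 0 < eps / (2 * (`|C| + 1)) by rewrite divr_gt0.
near=> n; rewrite distrC.
apply: (@le_trans _ _ (eps / (2 * (`|C| + 1)) * (B n t - B n 0) + eps / 2)).
  by near: n; apply: QE => //; rewrite divr_gt0.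
rewrite [leRHS]splitr lerD2r.
have -> : eps / 2 = eps / (2 * (`|C| + 1)) * (`|C| + 1).
  by field; rewrite gt_eqF// ltr_wpDl.
rewrite ler_pM2l//; apply: (@le_trans _ _ C).
  by near: n; exact: BC.
by rewrite (le_trans (ler_norm C))// lerDl.
Unshelve. all: by end_near. Qed.

End interval_induction.

(** * Partition times *)

Section time_index.
Context {R : realType}.
Implicit Types (p : time_partition R) (t b : R).

Lemma time_exceeds p b : exists j, b <= p j.
Proof.
have /cvgryPge/(_ b) := time_cvgy p.
by move=> /filter_ex.
Qed.

(** The number of times of p before b: a sum over the times before b is then
    an initial sum, which makes it additive in b. *)
Definition hit_index p b : nat := ex_minn (time_exceeds p b).

Lemma time_le p i j : (i <= j)%N -> p i <= p j.
Proof.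
move=> ij; apply: (homo_leq (f := p) (r := <=%O)) ij => //.
- by move=> ? ? ?; exact: le_trans.
- by move=> k; exact/ltW/time_lt.
Qed.

Lemma hit_indexP p b j : (p j < b) = (j < hit_index p b)%N.
Proof.
rewrite /hit_index; case: ex_minnP => k bk kmin.
apply/idP/idP.
  by move=> pjb; rewrite ltnNge; apply/negP => /(time_le p) /(le_trans bk); rewrite leNgt pjb.
by rewrite ltnNge => /negP jk; rewrite ltNge; apply/negP => /kmin.
Qed.

Lemma le_hit_index p b b' : b <= b' -> (hit_index p b <= hit_index p b')%N.
Proof.
move=> bb'; rewrite leqNgt -hit_indexP -leNgt (le_trans bb')//.
by rewrite leNgt hit_indexP ltnn.
Qed.

Lemma hit_index0 p : hit_index p 0 = 0%N.
Proof. by apply/eqP; rewrite -leqn0 leqNgt -hit_indexP time0 ltxx. Qed.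

Lemma hit_index_gt0 p b : 0 < b -> (0 < hit_index p b)%N.
Proof. by move=> b0; rewrite -hit_indexP time0. Qed.

Lemma hit_index_prednK p b : 0 < b -> (hit_index p b).-1.+1 = hit_index p b.
Proof. by move=> b0; rewrite prednK// hit_index_gt0. Qed.

Lemma time_hit_index p b : b <= p (hit_index p b).
Proof. by rewrite leNgt hit_indexP ltnn. Qed.

Lemma time_pred_hit_index p b : 0 < b -> p (hit_index p b).-1 < b.
Proof. by move=> b0; rewrite hit_indexP hit_index_prednK. Qed.

Lemma time_ge0 p i : 0 <= p i.
Proof. by rewrite -(time0 p) time_le. Qed.

Lemma limn_series_hit p t (a : nat -> R) : (forall i, t <= p i -> a i = 0) ->
  limn (series a) = \sum_(0 <= i < hit_index p t) a i.
Proof.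
move=> a0; apply: lim_near_cst => //; exists (hit_index p t) => // k /= hk.
rewrite /series/= (big_cat_nat (leq0n _) hk)//= [X in _ + X]big_nat_cond.
rewrite [X in _ + X]big1 ?addr0// => i /andP[/andP[hi _] _].
by apply: a0; rewrite leNgt hit_indexP -leqNgt.
Qed.

End time_index.

Section time_index_limits.
Context {R : realType}.
Variable P : nat -> time_partition R.
Hypothesis hP : mesh_vanishes P.

Lemma mesh_near (e : R) : 0 < e ->
  \forall n \near \oo, forall i, P n i.+1 - P n i < e.
Proof.
move=> e0; have : \forall n \near \oo, (mesh (P n) < e%:E)%E.
  have /fine_cvgP[mfin m0] := hP.
  near=> n; rewrite -[mesh _]fineK; last by near: n.
  by rewrite lte_fin; near: n; exact: (cvgr_lt 0).
apply: filterS => n ne i; rewrite -lte_fin (le_lt_trans _ ne)//.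
apply: le_trans (ereal_sup_ubound _); last by exists i.
by rewrite lee_fin ler_norm.
Unshelve. all: by end_near. Qed.

(** The last time before b approaches b strictly from the left, and the next
    one from the right with equality allowed. So the cell that contains b sees
    the full jump of a path at b in the limit. *)
Lemma time_pred_hit_index_cvg b : 0 < b ->
  P n (hit_index (P n) b).-1 @[n --> \oo] --> b^'-.
Proof.
move=> b0 A [e /= e0 eA].
suff : \forall n \near \oo, A (P n (hit_index (P n) b).-1) by [].
near=> n.
have Pb : P n (hit_index (P n) b).-1 < b by exact: time_pred_hit_index.
apply: eA => //=; rewrite ger0_norm ?subr_ge0 ?(ltW Pb)//.
have : P n (hit_index (P n) b).-1.+1 - P n (hit_index (P n) b).-1 < e.
  by near: n; apply: filterS (mesh_near e0) => n; apply.
rewrite hit_index_prednK//; apply: le_lt_trans; rewrite lerD2r.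
exact: time_hit_index.
Unshelve. all: by end_near. Qed.

Lemma time_hit_index_cvg b : 0 < b ->
  P n (hit_index (P n) b) @[n --> \oo] --> within (fun u => b <= u) (nbhs b).
Proof.
move=> b0 A [e /= e0 eA].
suff : \forall n \near \oo, A (P n (hit_index (P n) b)) by [].
near=> n.
have bP : b <= P n (hit_index (P n) b) by exact: time_hit_index.
apply: eA => //=; rewrite distrC ger0_norm ?subr_ge0//.
have : P n (hit_index (P n) b).-1.+1 - P n (hit_index (P n) b).-1 < e.
  by near: n; apply: filterS (mesh_near e0) => n; apply.
rewrite hit_index_prednK//; apply: le_lt_trans; rewrite lerD2l lerN2.
exact/ltW/time_pred_hit_index.
Unshelve. all: by end_near. Qed.

End time_index_limits.

(** * Left limits along the partitions *)

Section left_limits.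
Context {R : realType} {V : normedModType R}.
Implicit Types X : R -> V.

Lemma left_lim_cvg X t : cadlag X -> 0 < t -> X s @[s --> t^'-] --> left_lim X t.
Proof. by move=> [_ cX] t0; rewrite /left_lim leNgt t0/=; exact: cX. Qed.

Lemma left_lim_eq X t l : 0 < t -> X s @[s --> t^'-] --> l -> left_lim X t = l.
Proof. by move=> t0 cX; rewrite /left_lim leNgt t0/=; exact/cvg_lim. Qed.

Variable P : nat -> time_partition R.
Hypothesis hP : mesh_vanishes P.

Lemma left_cell_cvg X b : cadlag X -> 0 < b ->
  X (P n (hit_index (P n) b).-1) @[n --> \oo] --> left_lim X b.
Proof.
move=> cX b0; apply: (cvg_comp _ _ (time_pred_hit_index_cvg hP b0)).
exact: left_lim_cvg.
Qed.

Lemma right_cell_cvg X b t : cadlag X -> 0 < b -> b <= t ->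
  X (Num.min (P n (hit_index (P n) b)) t) @[n --> \oo] --> X b.
Proof.
move=> cX b0 bt.
have : Num.min (P n (hit_index (P n) b)) t @[n --> \oo] -->
    within (fun u => b <= u) (nbhs b).
  move=> A [e /= e0 eA].
  suff : \forall n \near \oo, A (Num.min (P n (hit_index (P n) b)) t) by [].
  have H : \forall u \near within (fun u => b <= u) (nbhs b),
      (ball b e `&` [set u | b <= u]) u.
    by exists e => // x ? ?; split.
  have {}H := time_hit_index_cvg hP b0 H.
  near=> n.
  have [Pe bP] : (ball b e `&` [set u | b <= u]) (P n (hit_index (P n) b)).
    by near: n; exact: H.
  apply: eA => /=; last by rewrite le_min bP bt.
  move: Pe => /=; rewrite /ball /= !(distrC b).
  rewrite !ger0_norm ?subr_ge0// ?le_min ?bP ?bt//.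
  by apply: le_lt_trans; rewrite lerD2r ge_min lexx.
move=> /cvg_comp; apply.
by apply: cvg_at_right_within; case: cX => cX _; apply: cX; exact: ltW.
Unshelve. all: by end_near. Qed.

End left_limits.

(** * Functions of finite variation *)

Section controlled_paths.
Context {R : realType}.
Implicit Types (A F V j : R -> R).

(** A substitute for the total variation that is easy to produce: it adds up
    under sums of paths, and any nondecreasing function controls itself. *)
Definition controls V F :=
  forall u v, 0 <= u -> u <= v -> `|F v - F u| <= V v - V u.

Definition right_cont V := forall t, 0 <= t -> V s @[s --> t^'+] --> V t.

Lemma controls_nd V F u v : controls V F -> 0 <= u -> u <= v -> V u <= V v.
Proof. by move=> cVF u0 uv; rewrite -subr_ge0 (le_trans _ (cVF u v u0 uv)). Qed.

Lemma controlsD V1 V2 F1 F2 : controls V1 F1 -> controls V2 F2 ->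
  controls (V1 \+ V2) (F1 \+ F2).
Proof.
move=> c1 c2 u v u0 uv /=; move: (c1 u v u0 uv) (c2 u v u0 uv).
rewrite (_ : F1 v + F2 v - (F1 u + F2 u) = F1 v - F1 u + (F2 v - F2 u)); last by ring.
by move=> h1 h2; apply: (le_trans (ler_normD _ _)); lra.
Qed.

Lemma controlsZ V F c : controls V F -> controls (fun t => `|c| * V t) (fun t => c * F t).
Proof.
move=> cVF u v u0 uv; rewrite -!mulrBr normrM ler_wpM2l//; exact: cVF.
Qed.

Lemma nd_left_cvg F t : 0 < t ->
  (forall u v, 0 <= u -> u <= v -> F u <= F v) -> cvg (F s @[s --> t^'-]).
Proof.
move=> t0 ndF; apply: nondecreasing_at_left_is_cvgr.
- near=> x => y z; rewrite !in_itv/= => /andP[xy _] /andP[xz _] yz.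
  apply: ndF => //; rewrite (le_trans _ (ltW xy))//; near: x.
  by apply: filterS (nbhs_left_gt t0) => x /ltW.
- near=> x; exists (F t) => _ [y /= + <-]; rewrite in_itv/= => /andP[xy yt].
  apply: ndF; last exact: ltW.
  by rewrite (le_trans _ (ltW xy))//; near: x; apply: filterS (nbhs_left_gt t0) => x /ltW.
Unshelve. all: by end_near. Qed.

(** V + F and V - F are nondecreasing and F is half of their difference;
    right continuity passes from V to F. *)
Lemma controls_FV V F : controls V F -> right_cont V -> FV_loc F.
Proof.
move=> cVF rV.
have ndp u v : 0 <= u -> u <= v -> V u + F u <= V v + F v.
  by move=> u0 uv; move: (cVF u v u0 uv); rewrite ler_norml => /andP[]; lra.
have ndm u v : 0 <= u -> u <= v -> V u - F u <= V v - F v.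
  by move=> u0 uv; move: (cVF u v u0 uv); rewrite ler_norml => /andP[]; lra.
pose p t := 2^-1 * (V t + F t); pose q t := 2^-1 * (V t - F t).
have FE : F = p \+ \- q by apply/funext => t; rewrite /p /q/=; field.
split; first split.
- move=> t t0; apply/cvgrPdist_le => e e0.
  near=> s.
  have ts : t <= s by near: s; exact: nbhs_right_ge.
  have Vts : `|V t - V s| <= e.
    by near: s; have /cvgrPdist_le/(_ _ e0) := rV t t0.
  rewrite distrC (le_trans (cVF t s t0 ts))// (le_trans _ Vts)//.
  by rewrite distrC ler_norm.
- move=> t t0; rewrite FE; apply: is_cvgD; last apply: is_cvgN;
    by apply: is_cvgMr; exact: nd_left_cvg.
- move=> T; rewrite le_eqVlt => /predU1P[<-|T0]; first exact: bounded_variationxx.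
  rewrite FE; apply: bounded_variationD => //; last apply: bounded_variationN.
  + apply: nondecreasing_bounded_variation => x y.
    rewrite !in_itv/= => /andP[x0 _] _ xy.
    by rewrite ler_pM2l ?invr_gt0//; exact: ndp.
  + apply: nondecreasing_bounded_variation => x y.
    rewrite !in_itv/= => /andP[x0 _] _ xy.
    by rewrite ler_pM2l ?invr_gt0//; exact: ndm.
Unshelve. all: by end_near. Qed.

Lemma FV_locN A : FV_loc A -> FV_loc (\- A).
Proof.
move=> [[rA lA] bA]; split; first split.
- by move=> t t0; apply: cvgN; exact: rA.
- by move=> t t0; apply: is_cvgN; exact: lA.
- by move=> T T0; apply: bounded_variationN => //; exact: bA.
Qed.

Lemma neg_var_nd A : FV_loc A -> {homo neg_var A : x y / x <= y}.
Proof.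
move=> [_ bA] x y xy; rewrite /neg_var.
have y0 : 0 <= Num.max 0 y by rewrite le_max lexx.
apply: (@fine_neg_tv_nondecreasing _ 0 (Num.max 0 y)); first exact: bA.
- by rewrite in_itv/= le_max lexx/= ge_max y0 /= le_max xy orbT.
- by rewrite in_itv/= y0 lexx.
- by rewrite ge_max y0 /= le_max xy orbT.
Qed.

Lemma neg_var_rc A : FV_loc A -> right_continuous (neg_var A).
Proof.
move=> [[rA lA] bA] x; have [x0|x0] := ltP x 0.
  have -> : neg_var A x = fine (neg_tv 0 A 0) by rewrite /neg_var max_l ?ltW.
  apply: cvg_near_cst; near=> y.
  rewrite /neg_var max_l//; apply/ltW.
  by near: y; exact: nbhs_right_lt.
have -> : neg_var A x = fine (neg_tv 0 A x) by rewrite /neg_var max_r.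
have := @neg_tv_right_continuous R 0 x (x + 1) A x0.
rewrite ltrDl ltr01 => /(_ isT (bA _ (addr_ge0 x0 ler01)) (rA _ x0)).
apply: cvg_trans; apply: near_eq_cvg; near=> y.
by rewrite /neg_var max_r//= (le_trans x0).
Unshelve. all: by end_near. Qed.

Lemma pos_varE A : pos_var A = neg_var (\- A).
Proof. by []. Qed.

Lemma pos_neg_var A t : FV_loc A -> 0 <= t -> A t = pos_var A t - neg_var A t.
Proof.
move=> [_ bA] t0; rewrite /pos_var /neg_var max_r//.
have := @bounded_variation_pos_neg_tvE _ 0 t A (bA _ t0) t.
by rewrite in_itv/= t0 lexx => /(_ isT) ->.
Qed.

(** The total variation on [0, t], as the sum of the two cumulative functions
    against which Stieltjes integrals are defined. *)
Definition tot_var A := pos_var A \+ neg_var A.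

Lemma tot_var_controls A : FV_loc A -> controls (tot_var A) A.
Proof.
move=> fA u v u0 uv; rewrite (pos_neg_var fA u0) (pos_neg_var fA (le_trans u0 uv)).
have := neg_var_nd fA uv; have := neg_var_nd (FV_locN fA) uv.
rewrite -pos_varE /tot_var/= => h1 h2.
by rewrite ler_norml; apply/andP; split; lra.
Qed.

Lemma tot_var_right_cont A : FV_loc A -> right_cont (tot_var A).
Proof.
move=> fA t t0; apply: cvgD; last exact: neg_var_rc.
exact: (neg_var_rc (FV_locN fA)).
Qed.

Lemma stieltjes_measure_itv (F : cumulative R R) (u v : R) : u <= v ->
  lebesgue_stieltjes_measure F `]u, v]%classic = (F v - F u)%:E.
Proof.
move=> uv; rewrite /lebesgue_stieltjes_measure /measure_extension/=.
by rewrite measurable_mu_extE/= ?wlength_itv_bnd//; exact: is_ocitv.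
Qed.

Lemma ls_measure_itv F (u v : R) : {homo F : x y / x <= y} ->
  right_continuous F -> u <= v -> ls_measure F `]u, v]%classic = (F v - F u)%:E.
Proof.
move=> ndF rcF uv; rewrite /ls_measure; case: pselect => [H|]; last by case; split.
exact: stieltjes_measure_itv.
Qed.

(** A jump is a limit of increments, each bounded by an increment of V. *)
Lemma jump_controls V A s r : controls V A -> cadlag A -> 0 <= r -> r < s ->
  `|jump A s| <= V s - V r.
Proof.
move=> cVA cA r0 rs; have s0 : 0 < s by exact: le_lt_trans rs.
have cv : `|A s - A x| @[x --> s^'-] --> `|jump A s|.
  apply: cvg_norm; apply: cvgB; first exact: cvg_cst.
  exact: left_lim_cvg.
rewrite -(cvg_lim _ cv)//; apply: limr_le; first by apply/cvg_ex; eexists; exact: cv.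
near=> x.
have rx : r <= x by apply/ltW; near: x; exact: nbhs_left_gt.
have xs : x <= s by apply/ltW; near: x; exact: nbhs_left_lt.
apply: (le_trans (cVA x s (le_trans r0 rx) xs)).
by rewrite lerD2l lerN2 (controls_nd cVA).
Unshelve. all: by end_near. Qed.

(** Jump times in increasing order are separated by disjoint intervals, on
    each of which V grows by at least the jump: induction on the sorted list. *)
Lemma sum_jump_le V j (u w : R) (s : seq R) :
  (forall x y, 0 <= x -> x <= y -> V x <= V y) ->
  (forall x y, 0 <= x -> x < y -> j y <= V y - V x) ->
  0 <= u -> u <= w -> uniq s -> {in s, forall x, u < x <= w} ->
  \sum_(x <- s) j x <= V w - V u.
Proof.
move=> ndV jV u0 uw us sP.
rewrite -(perm_big _ (permEl (perm_sort <=%O s))) /=.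
have := sort_lt_sorted s; rewrite us.
have : {in sort <=%O s, forall x, u < x <= w} by move=> x; rewrite mem_sort; exact: sP.
elim: (sort _ _) u u0 uw {sP} => [|x l IH] u u0 uw sP srt.
  by rewrite big_nil subr_ge0 ndV.
have /andP[ux xw] : u < x <= w by apply: sP; rewrite mem_head.
have x0 : 0 <= x by rewrite (le_trans u0)// ltW.
rewrite big_cons (_ : V w - V u = V x - V u + (V w - V x)); last by ring.
rewrite lerD ?jV// IH//; last exact: path_sorted srt.
move=> y yl; have /andP[_ ->] : u < y <= w by apply: sP; rewrite inE yl orbT.
by rewrite andbT; move: srt => /=; rewrite lt_path_sortedE => /andP[/allP/(_ _ yl)].
Qed.

Lemma esum_jump_le V j (u w : R) :
  (forall x y, 0 <= x -> x <= y -> V x <= V y) ->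
  (forall x y, 0 <= x -> x < y -> j y <= V y - V x) ->
  0 <= u -> u <= w ->
  (\esum_(x in `]u, w]) (j x)%:E <= (V w - V u)%:E)%E.
Proof.
move=> ndV jV u0 uw; apply: ge_ereal_sup => _ [D [finD DI] <-].
rewrite fsbig_finite//= sumEFin lee_fin; apply: sum_jump_le => // [|x].
  exact: finmap.fset_uniq.
by rewrite in_fset_set// inE => /DI; rewrite /= in_itv.
Qed.

End controlled_paths.

(** * Unordered sums *)

Section unordered_sums.
Context {R : realType}.
Implicit Types (D : set R) (u v : R -> R) (c : R).

Local Notation rsummable D u := (summable D (EFin \o u)).
Local Notation rsum D u := (fine (esum D (EFin \o u))).

Lemma summable_le D u v : (forall x, D x -> `|u x| <= v x) ->
  rsummable D v -> rsummable D u.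
Proof.
move=> uv; apply: le_lt_trans; apply: le_esum => x Dx /=.
by rewrite lee_fin (le_trans (uv x Dx))// ler_norm.
Qed.

Lemma summable_esum_le D u (M : R) :
  (\esum_(x in D) (`|u x|)%:E <= M%:E)%E -> rsummable D u.
Proof. by move=> uM; apply: le_lt_trans uM _; rewrite ltry. Qed.

Lemma summable_real_sub D D' u : D' `<=` D -> rsummable D u -> rsummable D' u.
Proof.
move=> D'D; apply: le_lt_trans; rewrite [leRHS](esumID D')//=.
by rewrite (setIidr D'D) leeDl// esum_ge0.
Qed.

Lemma summable_realD D u v : rsummable D u -> rsummable D v ->
  rsummable D (fun x => u x + v x).
Proof. by move=> su sv; have := summableD su sv. Qed.

Lemma summable_realZ D c u : rsummable D u -> rsummable D (fun x => c * u x).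
Proof.
have [->|c0] := eqVneq c 0.
  move=> _; apply: (@summable_esum_le _ _ 0).
  by rewrite esum1// => x _; rewrite mul0r normr0.
rewrite /summable => su.
suff /le_lt_trans : (\esum_(x in D) `|(EFin \o (fun x => c * u x)%R) x| <=
  `|c|%:E * \esum_(x in D) `|(EFin \o u) x|)%E.
  by apply; rewrite lte_mul_pinfty.
apply: ge_ereal_sup => _ [X [finX XD] <-].
under eq_fsbigr do rewrite /= normrM EFinM.
rewrite -ge0_mule_fsumr// lee_pmul2l//; last by rewrite lte_fin normr_gt0.
by apply: esum_ge; exists X.
Qed.

Lemma rsum_fin D u : (forall x, D x -> 0 <= u x) -> rsummable D u ->
  esum D (EFin \o u) \is a fin_num.
Proof.
move=> u0; rewrite summableE; congr (_ \is a fin_num).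
by apply: eq_esum => x Dx /=; rewrite ger0_norm// u0.
Qed.

Lemma rsumD D u v : (forall x, D x -> 0 <= u x) -> (forall x, D x -> 0 <= v x) ->
  rsummable D u -> rsummable D v ->
  rsum D (fun x => u x + v x) = rsum D u + rsum D v.
Proof.
move=> u0 v0 su sv; rewrite -fineD ?rsum_fin//; congr fine.
by rewrite -esumD.
Qed.

Lemma rsumZ D c u : 0 < c -> (forall x, D x -> 0 <= u x) -> rsummable D u ->
  rsum D (fun x => c * u x) = c * rsum D u.
Proof.
move=> c0 u0 su.
have H (k : R) (w : R -> R) : 0 < k -> (forall x, D x -> 0 <= w x) -> rsummable D w ->
    rsum D (fun x => k * w x) <= k * rsum D w.
  move=> k0 w0 sw.
  have fkw : esum D (EFin \o (fun x => k * w x)) \is a fin_num.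
    apply: rsum_fin; last exact: summable_realZ.
    by move=> x Dx; rewrite mulr_ge0 ?(ltW k0) ?w0.
  rewrite -lee_fin EFinM (fineK fkw) (fineK (rsum_fin w0 sw)).
  apply: ge_ereal_sup => _ [X [finX XD] <-].
  under eq_fsbigr do rewrite /= EFinM.
  have -> : (\sum_(i \in X) (k%:E * (w i)%:E) = k%:E * \sum_(i \in X) (w i)%:E)%E.
    rewrite !fsbig_finite//=; under eq_bigr do rewrite -EFinM.
    by rewrite !sumEFin -EFinM mulr_sumr.
  rewrite lee_pmul2l//.
  by apply: esum_ge; exists X.
apply: le_anti; rewrite H//=.
have := H c^-1 (fun x => c * u x).
rewrite invr_gt0 c0 => /(_ isT); rewrite -(ler_pM2l c0) mulrA divff ?gt_eqF// mul1r.
rewrite (_ : (fun x => c^-1 * (c * u x)) = u); last first.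
  by apply/funext => x; rewrite mulKf// gt_eqF.
apply; last exact: summable_realZ.
by move=> x Dx; rewrite mulr_ge0 ?(ltW c0) ?u0.
Qed.

Lemma rsum_le D u v : (forall x, D x -> u x <= v x) -> (forall x, D x -> 0 <= u x) ->
  rsummable D v -> rsum D u <= rsum D v.
Proof.
move=> uv u0 sv; rewrite -lee_fin !fineK ?rsum_fin//.
- by apply: le_esum => x Dx; rewrite /= lee_fin uv.
- by move=> x Dx; rewrite (le_trans (u0 x Dx)) ?uv.
- by apply: summable_le sv => x Dx; rewrite ger0_norm ?u0 ?uv.
Qed.

(** Any decomposition into a difference of nonnegative summable families
    computes the sum; linearity follows by choosing the decomposition. *)
Lemma unordered_sumE D u v : (forall x, D x -> 0 <= u x) ->
  (forall x, D x -> 0 <= v x) -> rsummable D u -> rsummable D v ->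
  unordered_sum D (fun x => u x - v x) = rsum D u - rsum D v.
Proof.
move=> u0 v0 su sv; rewrite /unordered_sum.
rewrite (_ : EFin \o _ = (EFin \o u) \- (EFin \o v))%E//.
rewrite (esumB su sv) ?fineB ?rsum_fin//.
Qed.

Let pos u x := Num.max (u x) 0.
Let neg u x := Num.max (- u x) 0.

Let pos_ge0 u x : 0 <= pos u x. Proof. by rewrite le_max lexx orbT. Qed.
Let neg_ge0 u x : 0 <= neg u x. Proof. by rewrite le_max lexx orbT. Qed.
Let posneg u x : u x = pos u x - neg u x.
Proof. by rewrite /pos /neg /Num.max; do 2 case: ifP; lra. Qed.
Let pos_le u x : pos u x <= `|u x|.
Proof. by rewrite ge_max normr_ge0 ler_norm. Qed.
Let neg_le u x : neg u x <= `|u x|.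
Proof. by rewrite ge_max normr_ge0 -normrN ler_norm. Qed.

Let spos D u : rsummable D u -> rsummable D (pos u).
Proof.
move=> su; apply: (@summable_le _ _ (fun x => `|u x|)).
  by move=> x _; rewrite ger0_norm.
by move: su; rewrite /summable/=; under eq_esum do rewrite -[`|u _|]normr_id.
Qed.

Let sneg D u : rsummable D u -> rsummable D (neg u).
Proof.
move=> su; apply: (@summable_le _ _ (fun x => `|u x|)).
  by move=> x _; rewrite ger0_norm.
by move: su; rewrite /summable/=; under eq_esum do rewrite -[`|u _|]normr_id.
Qed.

Let usumE D u : rsummable D u -> unordered_sum D u = rsum D (pos u) - rsum D (neg u).
Proof.
move=> su; rewrite -unordered_sumE//; [|exact: spos|exact: sneg].
by congr unordered_sum; apply/funext => x; rewrite -posneg.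
Qed.

Lemma eq_unordered_sum D u v : (forall x, D x -> u x = v x) ->
  unordered_sum D u = unordered_sum D v.
Proof.
move=> uv; rewrite /unordered_sum; congr (fine (_ - _)); apply: eq_esum => x Dx.
  by rewrite !funeposE /= uv.
by rewrite !funenegE /= uv.
Qed.

Lemma unordered_sumD D u v : rsummable D u -> rsummable D v ->
  unordered_sum D (fun x => u x + v x) = unordered_sum D u + unordered_sum D v.
Proof.
move=> su sv; rewrite (usumE su) (usumE sv).
rewrite (_ : (fun x => u x + v x) =
  (fun x => (pos u x + pos v x) - (neg u x + neg v x))); last first.
  by apply/funext => x; rewrite {1}(posneg u) {1}(posneg v); ring.
have [pu nu pv nv] := And4 (spos su) (sneg su) (spos sv) (sneg sv).
have pD w x : D x -> 0 <= pos w x by move=> _; exact: pos_ge0.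
have nD w x : D x -> 0 <= neg w x by move=> _; exact: neg_ge0.
rewrite (unordered_sumE _ _ (summable_realD pu pv) (summable_realD nu nv)).
- rewrite (rsumD (@pD u) (@pD v) pu pv) (rsumD (@nD u) (@nD v) nu nv).
  by ring.
- by move=> x Dx; rewrite addr_ge0 ?pD.
- by move=> x Dx; rewrite addr_ge0 ?nD.
Qed.

Lemma unordered_sumN D u : rsummable D u ->
  unordered_sum D (fun x => - u x) = - unordered_sum D u.
Proof.
move=> su; rewrite (usumE su) opprB -unordered_sumE//.
- by congr unordered_sum; apply/funext => x; rewrite {1}(posneg u); ring.
- exact: sneg.
- exact: spos.
Qed.

Lemma unordered_sum0 D : unordered_sum D (fun=> 0 : R) = 0.
Proof.
have s0 : rsummable D (fun=> 0 : R).
  by apply: (@summable_esum_le _ _ 0); rewrite esum1// => x _; rewrite normr0.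
by have := unordered_sumN s0; rewrite oppr0; lra.
Qed.

Lemma unordered_sumZ D c u : rsummable D u ->
  unordered_sum D (fun x => c * u x) = c * unordered_sum D u.
Proof.
move=> su.
have H (k : R) : 0 < k -> unordered_sum D (fun x => k * u x) = k * unordered_sum D u.
  move=> k0; rewrite (usumE su) mulrBr -!rsumZ//; [|exact: sneg|exact: spos].
  rewrite -unordered_sumE//; try (by move=> x Dx; rewrite mulr_ge0// ltW);
    try (by apply: summable_realZ; first [exact: spos|exact: sneg]).
  by congr unordered_sum; apply/funext => x; rewrite {1}(posneg u); ring.
have [c0|c0|<-] := ltgtP 0 c; first exact: H.
- rewrite -[in RHS](opprK c) mulNr -H ?oppr_gt0// -unordered_sumN; last exact: summable_realZ.
  by congr unordered_sum; apply/funext => x; ring.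
- rewrite mul0r -[RHS](unordered_sum0 D); congr unordered_sum.
  by apply/funext => x; rewrite mul0r.
Qed.

Lemma summable_real_sum D (I : Type) (r : seq I) (F : I -> R -> R) :
  (forall i, rsummable D (F i)) ->
  rsummable D (fun x => \sum_(i <- r) F i x).
Proof.
move=> sF; elim: r => [|i r IH].
  by apply: (@summable_esum_le _ _ 0); rewrite esum1// => x _; rewrite big_nil normr0.
under eq_fun do rewrite big_cons; exact: summable_realD.
Qed.

Lemma unordered_sum_sum D (I : Type) (r : seq I) (F : I -> R -> R) :
  (forall i, rsummable D (F i)) ->
  unordered_sum D (fun x => \sum_(i <- r) F i x) =
  \sum_(i <- r) unordered_sum D (F i).
Proof.
move=> sF; elim: r => [|i r IH].
  by under eq_fun do rewrite big_nil; rewrite unordered_sum0 big_nil.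
under eq_fun do rewrite big_cons.
by rewrite unordered_sumD ?IH ?big_cons//; exact: summable_real_sum.
Qed.

Lemma unordered_sum_le D u v (M : R) : (forall x, D x -> `|u x| <= v x) ->
  (\esum_(x in D) (v x)%:E <= M%:E)%E -> `|unordered_sum D u| <= M.
Proof.
move=> uv vM.
have v0 x : D x -> 0 <= v x by move=> Dx; rewrite (le_trans _ (uv x Dx)).
have sv : rsummable D v.
  apply: (@summable_esum_le _ _ M); rewrite (le_trans _ vM)//; apply: le_esum => x Dx.
  by rewrite ger0_norm// v0.
have su : rsummable D u by exact: summable_le sv.
have vM' : rsum D v <= M by rewrite -lee_fin fineK ?rsum_fin.
rewrite (usumE su) ler_norml.
have p0 : 0 <= rsum D (pos u).
  by rewrite fine_ge0// esum_ge0// => x _; rewrite lee_fin pos_ge0.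
have n0 : 0 <= rsum D (neg u).
  by rewrite fine_ge0// esum_ge0// => x _; rewrite lee_fin neg_ge0.
have pM : rsum D (pos u) <= M.
  apply: le_trans vM'; apply: rsum_le => [x Dx|x Dx|//]; last exact: pos_ge0.
  by rewrite (le_trans (pos_le _ _)) ?uv.
have nM : rsum D (neg u) <= M.
  apply: le_trans vM'; apply: rsum_le => [x Dx|x Dx|//]; last exact: neg_ge0.
  by rewrite (le_trans (neg_le _ _)) ?uv.
by apply/andP; split; lra.
Qed.

Let setUKl (A B : set R) : A `&` B = set0 -> (A `|` B) `&` ~` A = B.
Proof.
move=> AB; rewrite setIUl setICr set0U; apply/setIidl => x Bx Ax.
by have : (A `&` B) x by []; rewrite AB.
Qed.

Lemma summable_setU (A B : set R) u : A `&` B = set0 ->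
  rsummable A u -> rsummable B u -> rsummable (A `|` B) u.
Proof.
move=> AB sA sB; rewrite /summable (esumID A)// setUKl// setUK.
exact: lte_add_pinfty.
Qed.

Lemma unordered_sum_setU (A B : set R) u : A `&` B = set0 ->
  rsummable (A `|` B) u ->
  unordered_sum (A `|` B) u = unordered_sum A u + unordered_sum B u.
Proof.
move=> AB sAB.
have sA : rsummable A u by apply: summable_real_sub sAB; exact: subsetUl.
have sB : rsummable B u by apply: summable_real_sub sAB; exact: subsetUr.
have H (w : R -> R) : (forall x, 0 <= w x) -> rsummable A w -> rsummable B w ->
    rsum (A `|` B) w = rsum A w + rsum B w.
  move=> w0 swA swB; rewrite -fineD ?rsum_fin//.
  by rewrite (esumID A) ?setUKl ?setUK// => x _ /=; rewrite lee_fin.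
rewrite (usumE sAB) (usumE sA) (usumE sB).
rewrite (H _ (pos_ge0 u) (spos sA) (spos sB)) (H _ (neg_ge0 u) (sneg sA) (sneg sB)).
by ring.
Qed.

Let itvocI (a b c : R) : `]a, b]%classic `&` `]b, c]%classic = set0.
Proof.
apply/seteqP; split => x //=; rewrite !in_itv/= => -[/andP[_ xb] /andP[bx _]].
by move: bx; rewrite ltNge xb.
Qed.

Lemma unordered_sum_itvU (a b c : R) u : a <= b -> b <= c ->
  rsummable `]a, c] u ->
  unordered_sum `]a, c] u = unordered_sum `]a, b] u + unordered_sum `]b, c] u.
Proof.
move=> ab bc; have E : `]a, c]%classic = `]a, b]%classic `|` `]b, c]%classic.
  by rewrite -itv_bndbnd_setU ?bnd_simp.
by rewrite E => s; rewrite (unordered_sum_setU (itvocI _ _ _)).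
Qed.

Lemma summable_itvU (a b c : R) u : a <= b -> b <= c ->
  rsummable `]a, b] u -> rsummable `]b, c] u -> rsummable `]a, c] u.
Proof.
move=> ab bc s1 s2; have -> : `]a, c]%classic = `]a, b]%classic `|` `]b, c]%classic.
  by rewrite -itv_bndbnd_setU ?bnd_simp.
exact: (summable_setU (itvocI _ _ _)).
Qed.

Lemma summable_set1 (x : R) u : rsummable [set x] u.
Proof. by apply: (@summable_esum_le _ _ `|u x|); rewrite esum_set1. Qed.

Lemma unordered_sum_set1 (x : R) u : unordered_sum [set x] u = u x.
Proof.
rewrite (usumE (summable_set1 _ _)) [RHS]posneg; congr (_ - _); rewrite esum_set1//= lee_fin.
  exact: pos_ge0.
exact: neg_ge0.
Qed.

End unordered_sums.

(** * Cadlag paths near a point *)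

Section one_sided_germs.
Context {R : realType}.

Lemma near_left_itv (Q : R -> Prop) (v : R) : (\forall s \near v^'-, Q s) ->
  \forall u \near v^'-, forall s, u <= s -> s < v -> Q s.
Proof.
move=> [e /= e0 eQ]; near=> u => s us sv; apply: eQ => //=.
rewrite ger0_norm ?subr_ge0 ?(ltW sv)//.
apply: (@le_lt_trans _ _ (v - u)); first by rewrite lerD2l lerN2.
by rewrite ltrBlDr -ltrBlDl; near: u; apply: nbhs_left_gt; rewrite ltrBlDr ltrDl.
Unshelve. all: by end_near. Qed.

Lemma near_right_itv (Q : R -> Prop) (v : R) : Q v -> (\forall s \near v^'+, Q s) ->
  \forall w \near v^'+, forall s, v <= s -> s < w -> Q s.
Proof.
move=> Qv [e /= e0 eQ]; near=> w => s; rewrite le_eqVlt => /predU1P[<-//|vs sw].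
apply: eQ => //=.
rewrite distrC ger0_norm ?subr_ge0 ?(ltW vs)//.
apply: (@lt_le_trans _ _ (w - v)); first by rewrite ltrD2r.
by rewrite lerBlDl; apply/ltW; near: w; apply: nbhs_right_lt; rewrite ltrDl.
Unshelve. all: by end_near. Qed.

End one_sided_germs.

Section cadlag_local.
Context {R : realType} {V : normedModType R}.
Implicit Types (X : R -> V).

Lemma cadlag_near_left X v (S : set V) : cadlag X -> 0 < v ->
  nbhs (left_lim X v) S ->
  \forall u \near v^'-, forall s, u <= s -> s < v -> S (X s).
Proof.
by move=> cX v0 nS; apply: near_left_itv; exact: (left_lim_cvg cX v0 nS).
Qed.

Lemma cadlag_near_right X v (S : set V) : cadlag X -> 0 <= v ->
  nbhs (X v) S ->
  \forall w \near v^'+, forall s, v <= s -> s < w -> S (X s).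
Proof.
move=> cX v0 nS; apply: near_right_itv; first exact: nbhs_singleton.
by case: cX => rX _; exact: (rX v v0 S nS).
Qed.

Lemma nbhs_dist_le (c : V) (e : R) : 0 < e -> nbhs c [set x | `|x - c| <= e].
Proof.
move=> e0; apply/nbhs_ballP; exists e => // x; rewrite -ball_normE /= distrC.
exact: ltW.
Qed.

(** A bound on [u, w[ passes to the left limits on ]u, w], and this shift is
    why Riemann sums at left end points produce integrals of left limits. *)
Lemma left_lim_dist_le X c (e u w : R) : cadlag X -> 0 <= u ->
  (forall s, u <= s -> s < w -> `|X s - c| <= e) ->
  forall s, u < s -> s <= w -> `|left_lim X s - c| <= e.
Proof.
move=> cX u0 Xc s us sw; have s0 : 0 < s by exact: le_lt_trans us.
have cv : `|X x - c| @[x --> s^'-] --> `|left_lim X s - c|.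
  by apply: cvg_norm; apply: cvgB; [exact: left_lim_cvg | exact: cvg_cst].
rewrite -(cvg_lim _ cv)//; apply: limr_le; first by apply/cvg_ex; eexists; exact: cv.
near=> x; apply: Xc.
- by apply/ltW; near: x; exact: nbhs_left_gt.
- by apply: lt_le_trans sw; near: x; exact: nbhs_left_lt.
Unshelve. all: by end_near. Qed.

Lemma cadlag_bounded X (t : R) : cadlag X -> 0 <= t ->
  exists M, forall s, 0 <= s -> s <= t -> `|X s| <= M.
Proof.
move=> cX t0.
suff [M HM] : exists M, forall s, 0 <= s -> s < t -> `|X s| <= M.
  exists (Num.max M `|X t|) => s s0; rewrite le_eqVlt => /predU1P[->|st].
    by rewrite le_max lexx orbT.
  by rewrite le_max HM.
apply: (@cousin_additive _ (fun u v => exists M, forall s, u <= s -> s < v -> `|X s| <= M)) => //.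
- move=> u v w _ uv vw _ [M1 H1] [M2 H2]; exists (Num.max M1 M2) => s us sw.
  by rewrite le_max; have [sv|vs] := ltP s v; [rewrite H1|rewrite H2 ?orbT].
- by move=> v _ _; exists 0 => s vs; rewrite ltNge vs.
- move=> v v0 vt.
  have := cadlag_near_left cX v0 (nbhs_dist_le _ ltr01).
  apply: filterS => u Hu; exists (1 + `|left_lim X v|) => s us sv.
  rewrite -[X s](subrK (left_lim X v)) (le_trans (ler_normD _ _))//.
  by rewrite lerD2r; exact: Hu.
- move=> v v0 vt.
  have := cadlag_near_right cX v0 (nbhs_dist_le _ ltr01).
  apply: filterS => w Hw; exists (1 + `|X v|) => s vs sw.
  rewrite -[X s](subrK (X v)) (le_trans (ler_normD _ _))//.
  by rewrite lerD2r; exact: Hw.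
Qed.

End cadlag_local.

(** * Stieltjes integrals of left limits *)

Section stieltjes_of_left_limits.
Context {R : realType}.
Variable P : nat -> time_partition R.
Hypothesis hP : mesh_vanishes P.
Implicit Types (A F phi : R -> R).

(** The value of the path at the last partition time before s is a step
    function of s, and it tends to the left limit at s as the mesh vanishes. *)
Lemma left_lim_measurable phi (t : R) : cadlag phi ->
  measurable_fun (`]0, t]%classic : set (measurableTypeR R)) (left_lim phi).
Proof.
move=> cphi.
pose g k (x : measurableTypeR R) := phi (P k (hit_index (P k) x).-1).
apply: (measurable_fun_cvg (h := g)) => //.
- move=> k; apply: (@measurable_funS _ _ _ _
    (\bigcup_i (`]P k i, P k i.+1]%classic : set (measurableTypeR R)))).
  + by apply: bigcup_measurable => i _; exact: measurable_itv.
  + move=> x; rewrite /= in_itv/= => /andP[x0 _].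
    exists (hit_index (P k) x).-1 => //=; rewrite in_itv/= time_pred_hit_index//=.
    by rewrite hit_index_prednK// time_hit_index.
  + apply/measurable_fun_bigcup; first by move=> i; exact: measurable_itv.
    move=> i; apply: (eq_measurable_fun (cst (phi (P k i)))); last exact: measurable_cst.
    move=> x; rewrite inE/= in_itv/= => /andP[ix xi]; rewrite /g.
    suff -> : hit_index (P k) x = i.+1 by [].
    by apply/eqP; rewrite eqn_leq -hit_indexP ix andbT leqNgt -hit_indexP -leNgt.
- move=> x; rewrite /= in_itv/= => /andP[x0 _].
  exact: left_cell_cvg.
Qed.

Lemma stieltjes_estimate (G g : R -> R) (c e u w : R) :
  {homo G : x y / x <= y} -> right_continuous G -> u <= w ->
  measurable_fun (`]u, w]%classic : set (measurableTypeR R)) g ->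
  (forall s, u < s -> s <= w -> `|g s - c| <= e) ->
  (ls_measure G).-integrable `]u, w] (EFin \o g) /\
  `|\int[ls_measure G]_(s in `]u, w]) g s - c * (G w - G u)| <= e * (G w - G u).
Proof.
move=> ndG rG uw mg gc.
have muE : ls_measure G `]u, w]%classic = (G w - G u)%:E by exact: ls_measure_itv.
have mI : measurable (`]u, w]%classic : set (measurableTypeR R)) by exact: measurable_itv.
have muI : (ls_measure G `]u, w]%classic < +oo)%E by rewrite muE ltry.
have ig : (ls_measure G).-integrable `]u, w] (EFin \o g).
  apply: measurable_bounded_integrable => //.
  exists (`|c| + e); split; first exact: num_real.
  move=> M eM x; rewrite /= in_itv/= => /andP[ux xw].
  rewrite (le_trans _ (ltW eM))// -[g x](subrK c) (le_trans (ler_normD _ _))//.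
  by rewrite addrC lerD2l gc.
have ic k : (ls_measure G).-integrable `]u, w] (EFin \o cst k).
  apply: measurable_bounded_integrable => //.
  exists `|k|; split; first exact: num_real.
  by move=> M eM x _; exact: ltW.
split => //.
have -> : c * (G w - G u) = \int[ls_measure G]_(s in `]u, w]) c.
  by rewrite Rintegral_cst// muE.
have -> : e * (G w - G u) = \int[ls_measure G]_(s in `]u, w]) e.
  by rewrite Rintegral_cst// muE.
rewrite -RintegralB//; last exact: ic.
have igc : (ls_measure G).-integrable `]u, w] (EFin \o (fun s => g s - c)).
  exact: (integrableB mI ig (ic c)).
apply: (le_trans (le_normr_Rintegral mI igc)).
apply: le_Rintegral => //.
- exact: (integrable_norm igc).
- exact: ic.
- by move=> x; rewrite /= in_itv/= => /andP[]; exact: gc.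
Qed.

End stieltjes_of_left_limits.

(** * Riemann sums against functions of finite variation *)

Section jumps_of_finite_variation.
Context {R : realType}.
Implicit Types (A F V phi : R -> R).

Lemma summable_jump V A (u w : R) : controls V A -> cadlag A -> 0 <= u -> u <= w ->
  (\esum_(s in `]u, w]) (`|jump A s|)%:E <= (V w - V u)%:E)%E.
Proof.
move=> cVA cA u0 uw; apply: esum_jump_le => //.
- by move=> x y; exact: controls_nd cVA.
- by move=> x y x0 xy; exact: jump_controls.
Qed.

Lemma summable_mul_jump V A g (M u w : R) : controls V A -> cadlag A -> 0 <= u -> u <= w ->
  (forall s, u < s -> s <= w -> `|g s| <= M) ->
  summable `]u, w] (EFin \o (fun s => g s * jump A s)).
Proof.
move=> cVA cA u0 uw gM; apply: (@summable_le _ _ _ (fun s => M * `|jump A s|)).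
  move=> s; rewrite /= in_itv/= => /andP[us sw].
  by rewrite normrM ler_wpM2r// gM.
apply: summable_realZ; apply: (@summable_esum_le _ _ _ (V w - V u)).
by under eq_esum do rewrite normr_id; exact: summable_jump.
Qed.

Lemma disc_partB V A (u w : R) : controls V A -> cadlag A -> 0 <= u -> u <= w ->
  disc_part A w - disc_part A u = unordered_sum `]u, w] (jump A).
Proof.
move=> cVA cA u0 uw; rewrite /disc_part (@unordered_sum_itvU _ 0 u w)//.
  by rewrite addrAC subrr add0r.
apply: (@summable_esum_le _ _ _ (V w - V 0)).
by apply: summable_jump => //; exact: le_trans uw.
Qed.

(** The jumps over ]u, w] add up to at most the increment of V. *)
Lemma disc_part_controls V A : controls V A -> cadlag A -> controls V (disc_part A).
Proof.
move=> cVA cA u w u0 uw; rewrite (disc_partB cVA)//.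
by apply: (@unordered_sum_le _ _ _ (fun s => `|jump A s|)) => //; exact: summable_jump.
Qed.

Lemma cont_part_FV A : FV_loc A -> FV_loc (cont_part A).
Proof.
move=> fA; have [cA _] := fA; have cVA := tot_var_controls fA.
apply: (@controls_FV _ (tot_var A \+ tot_var A)).
  move=> u w u0 uw; rewrite /cont_part.
  have := cVA u w u0 uw; have := disc_part_controls cVA cA u0 uw.
  rewrite (_ : A w - disc_part A w - (A u - disc_part A u) =
    (A w - A u) - (disc_part A w - disc_part A u)); last by ring.
  by move=> h1 h2; rewrite (le_trans (ler_normB _ _))//= /=; lra.
by move=> t t0; apply: cvgD; exact: tot_var_right_cont.
Qed.

End jumps_of_finite_variation.

Section finite_variation_integral.
Context {R : realType}.
Variable P : nat -> time_partition R.
Hypothesis hP : mesh_vanishes P.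
Implicit Types (A F phi : R -> R).

Lemma summable_left_lim_jump F phi (t : R) :
  FV_loc F -> cadlag phi -> 0 <= t ->
  summable `]0, t] (EFin \o (fun s => left_lim phi s * jump F s)).
Proof.
move=> fF cphi t0; have [M phiM] := cadlag_bounded cphi t0.
apply: (summable_mul_jump (tot_var_controls fF) fF.1 (lexx 0) t0 (M := M)) => s s0 st.
rewrite -[X in `|X|]subr0.
apply: (left_lim_dist_le cphi (lexx 0) _ s0 st) => x x0 xt.
by rewrite subr0 phiM// ltW.
Qed.

Lemma fv_integrable_left_lim F phi (t : R) : FV_loc F -> cadlag phi -> 0 <= t ->
  fv_integrable F (left_lim phi) t.
Proof.
move=> fF cphi t0; have [M phiM] := cadlag_bounded cphi t0.
have bnd s : 0 < s -> s <= t -> `|left_lim phi s - 0| <= M.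
  move=> s0 st; apply: (left_lim_dist_le cphi (lexx 0) _ s0 st) => x x0 xt.
  by rewrite subr0 phiM// ltW.
have mphi := left_lim_measurable hP (t := t) cphi.
split.
- have [] := stieltjes_estimate (neg_var_nd (FV_locN fF)) (neg_var_rc (FV_locN fF)) t0 mphi bnd.
  by [].
- have [] := stieltjes_estimate (neg_var_nd fF) (neg_var_rc fF) t0 mphi bnd.
  by [].
Qed.

Lemma fv_intB F phi (u w : R) : FV_loc F -> cadlag phi -> 0 <= u -> u <= w ->
  fv_int F (left_lim phi) w - fv_int F (left_lim phi) u =
  \int[ls_measure (pos_var F)]_(s in `]u, w]) left_lim phi s -
  \int[ls_measure (neg_var F)]_(s in `]u, w]) left_lim phi s.
Proof.
move=> fF cphi u0 uw.
have w0 : 0 <= w by exact: le_trans uw.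
have [ip ineg] := fv_integrable_left_lim fF cphi w0.
have split_int (mu : {measure set (measurableTypeR R) -> \bar R}) :
    mu.-integrable `]0, w] (EFin \o left_lim phi) ->
    \int[mu]_(s in `]0, w]) left_lim phi s =
    \int[mu]_(s in `]0, u]) left_lim phi s + \int[mu]_(s in `]u, w]) left_lim phi s.
  move=> iw; have E : `]0, w]%classic = `]0, u]%classic `|` `]u, w]%classic.
    by rewrite -itv_bndbnd_setU ?bnd_simp.
  have mI (x y : R) : measurable (`]x, y]%classic : set (measurableTypeR R)).
    exact: measurable_itv.
  rewrite E (Rintegral_setU (mI _ _) (mI _ _)) -?E//.
  apply/disj_setPS => x /=; rewrite !in_itv/= => -[/andP[_ xu] /andP[ux _]].
    by move: ux; rewrite ltNge xu.
rewrite /fv_int (split_int _ ip) (split_int _ ineg).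
move: (Rintegral _ _ _) (Rintegral _ _ _) (Rintegral _ _ _) (Rintegral _ _ _) => x1 x2 x3 x4.
by ring.
Qed.

(** The estimate that an integrand close to a constant satisfies against each
    of the two cumulative functions of F, hence against F with its variation. *)
Lemma fv_int_estimate F phi (c e u w : R) : FV_loc F -> cadlag phi -> 0 <= u -> u <= w ->
  (forall s, u <= s -> s < w -> `|phi s - c| <= e) ->
  `|fv_int F (left_lim phi) w - fv_int F (left_lim phi) u - c * (F w - F u)| <=
    e * (tot_var F w - tot_var F u).
Proof.
move=> fF cphi u0 uw phic; rewrite fv_intB//.
have w0 : 0 <= w by exact: le_trans uw.
have mphi : measurable_fun (`]u, w]%classic : set (measurableTypeR R)) (left_lim phi).
  apply: measurable_funS (left_lim_measurable hP (t := w) cphi) => //.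
  move=> x; rewrite /= !in_itv/= => /andP[ux ->]; rewrite andbT.
  exact: le_lt_trans ux.
have bnd := left_lim_dist_le cphi u0 phic.
have [_ h1] := stieltjes_estimate (neg_var_nd (FV_locN fF)) (neg_var_rc (FV_locN fF)) uw mphi bnd.
have [_ h2] := stieltjes_estimate (neg_var_nd fF) (neg_var_rc fF) uw mphi bnd.
rewrite -pos_varE in h1.
rewrite (pos_neg_var fF w0) (pos_neg_var fF u0) /tot_var/=.
set p := (X in X - _ - _); set q := (X in _ - X - _).
rewrite (_ : p - q - _ = (p - c * (pos_var F w - pos_var F u)) -
   (q - c * (neg_var F w - neg_var F u))); last by ring.
by rewrite (le_trans (ler_normB _ _))//; move: h1 h2; rewrite -/p -/q; lra.
Qed.

(** Where phi is within e of a constant c, both the Riemann sum and the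
    expected limit are c (F w - F u) up to e times a variation: the former
    because the weights sum to about F w - F u, the latter because F is the sum
    of its continuous part and of its jumps. [additive_limit] concludes. The
    weights are arbitrary, and not the increments of F, because products of
    increments of X are to be used with F a covariation. *)
Lemma riemann_sum_FV F phi (w b : nat -> nat -> R) (t C : R) :
  0 <= t -> FV_loc F -> cadlag phi ->
  (forall n i, `|w n i| <= b n i) ->
  (\forall n \near \oo, \sum_(0 <= i < hit_index (P n) t) b n i <= C) ->
  (forall v, 0 < v -> v <= t ->
    \sum_(0 <= i < hit_index (P n) v) w n i @[n --> \oo] --> F v - F 0) ->
  \sum_(0 <= i < hit_index (P n) t) phi (P n i) * w n i @[n --> \oo] -->
    fv_int (cont_part F) (left_lim phi) t +
    unordered_sum `]0, t] (fun s => left_lim phi s * jump F s).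
Proof.
move=> t0 fF cphi wb bC wF.
have fFc := cont_part_FV fF.
have [cF _] := fF; have cVF := tot_var_controls fF.
pose S n v := \sum_(0 <= i < hit_index (P n) v) phi (P n i) * w n i.
pose V := tot_var F \+ tot_var (cont_part F).
pose B n v := \sum_(0 <= i < hit_index (P n) v) b n i + V v.
pose I v := fv_int (cont_part F) (left_lim phi) v +
    unordered_sum `]0, v] (fun s => left_lim phi s * jump F s).
have [M phiM] := cadlag_bounded cphi t0.
have phi_bnd s : 0 < s -> s <= t -> `|left_lim phi s| <= M.
  move=> s0 st; rewrite -[X in `|X|]subr0.
  apply: (left_lim_dist_le cphi (lexx 0) _ s0 st) => x x0 xt.
  by rewrite subr0 phiM// ltW.
have I0 : I 0 = 0.
  rewrite /I /fv_int (_ : `]0, 0]%classic = set0); last by rewrite set_itvoc0.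
  rewrite !Rintegral_set0 subrr add0r -(unordered_sum0 (set0 : set R)).
  exact: eq_unordered_sum.
have S0 n : S n 0 = 0 by rewrite /S hit_index0 big_geq.
have wF' v : 0 <= v -> v <= t ->
    \sum_(0 <= i < hit_index (P n) v) w n i @[n --> \oo] --> F v - F 0.
  rewrite le_eqVlt => /predU1P[<- _|]; last exact: wF.
  by rewrite subrr; under eq_fun do rewrite hit_index0 big_geq//; exact: cvg_cst.
suff : S n t - S n 0 @[n --> \oo] --> I t - I 0.
  by rewrite I0 subr0; under eq_fun do rewrite S0 subr0.
apply: (@additive_limit _ S B I (C + V t - V 0)) => //.
  apply: filterS bC => n bC.
  by rewrite /B hit_index0 [X in _ - (X + _)]big_geq//; lra.
move=> e e0.
exists (fun u v => exists c, forall s, u <= s -> s < v -> `|phi s - c| <= e); last first.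
  split.
  - move=> v v0 vt.
    have := cadlag_near_left cphi v0 (nbhs_dist_le (left_lim phi v) e0).
    by apply: filterS => u Hu; exists (left_lim phi v).
  - move=> v v0 vt.
    have := cadlag_near_right cphi v0 (nbhs_dist_le (phi v) e0).
    by apply: filterS => w' Hw; exists (phi v).
move=> u v u0 uv vt [c phic] eta eta0.
have uv' := ltW uv; have v0 : 0 <= v by exact: le_trans uv'.
have ut : u <= t by exact: le_trans vt.
have SE n : S n v - S n u =
    \sum_(hit_index (P n) u <= i < hit_index (P n) v) phi (P n i) * w n i.
  by rewrite /S (big_cat_nat (leq0n _) (le_hit_index (P n) uv'))/= addrAC subrr add0r.
have BE n : B n v - B n u =
    \sum_(hit_index (P n) u <= i < hit_index (P n) v) b n i + (V v - V u).
  by rewrite /B (big_cat_nat (leq0n _) (le_hit_index (P n) uv'))/=; ring.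
have WE n : \sum_(0 <= i < hit_index (P n) v) w n i -
            \sum_(0 <= i < hit_index (P n) u) w n i =
    \sum_(hit_index (P n) u <= i < hit_index (P n) v) w n i.
  by rewrite (big_cat_nat (leq0n _) (le_hit_index (P n) uv'))/= addrAC subrr add0r.
(* [hit_indexP] says that the times summed over lie in [u, v[. *)
have sum_side n : `|S n v - S n u -
      c * \sum_(hit_index (P n) u <= i < hit_index (P n) v) w n i| <=
    e * \sum_(hit_index (P n) u <= i < hit_index (P n) v) b n i.
  rewrite SE !mulr_sumr -sumrB (le_trans (ler_norm_sum _ _ _))//.
  rewrite big_nat_cond [leRHS]big_nat_cond; apply: ler_sum => i /andP[/andP[ui iv] _].
  rewrite -mulrBl normrM; apply: ler_pM => //; apply: phic.
    by rewrite leNgt hit_indexP -leqNgt.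
  by rewrite hit_indexP.
have int_side : `|I v - I u - c * (F v - F u)| <= e * (V v - V u).
  have h1 := fv_int_estimate fFc cphi u0 uv' phic.
  have sm : forall x y, 0 <= x -> x <= y -> y <= t ->
      summable `]x, y] (EFin \o (fun s => left_lim phi s * jump F s)).
    move=> x y x0 xy yt; apply: (summable_mul_jump cVF cF x0 xy (M := M)) => s xs sy.
    by apply: phi_bnd; [exact: le_lt_trans xs | exact: le_trans yt].
  have sj : summable `]u, v] (EFin \o jump F).
    by apply: (@summable_esum_le _ _ _ (tot_var F v - tot_var F u)); exact: summable_jump.
  have h2 : `|unordered_sum `]u, v] (fun s => left_lim phi s * jump F s) -
      c * (disc_part F v - disc_part F u)| <= e * (tot_var F v - tot_var F u).
    rewrite (disc_partB cVF)// -unordered_sumZ// -unordered_sumN; last exact: summable_realZ.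
    rewrite -unordered_sumD; [|exact: sm|]; last first.
      rewrite (_ : (fun x => _) = (fun x => (- c) * jump F x)); last first.
        by apply/funext => x; ring.
      exact: summable_realZ.
    apply: (@unordered_sum_le _ _ _ (fun s => e * `|jump F s|)).
      move=> s; rewrite /= in_itv/= => /andP[us sv].
      rewrite -mulrBl normrM ler_wpM2r//.
      exact: (left_lim_dist_le cphi u0 phic us sv).
    rewrite mulrBr; apply: (@esum_jump_le _ (fun s => e * tot_var F s)) => //.
    - by move=> x y x0 xy; rewrite ler_pM2l// (controls_nd cVF).
    - by move=> x y x0 xy; rewrite -mulrBr ler_pM2l// jump_controls.
  rewrite /I (unordered_sum_itvU u0 uv' (sm 0 v (lexx 0) v0 vt)).
  have FE : F v - F u = (cont_part F v - cont_part F u) + (disc_part F v - disc_part F u).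
    by rewrite /cont_part; ring.
  move: h1 h2; rewrite FE /V/=.
  move: (fv_int _ _ _) (fv_int _ _ _) (unordered_sum _ _) (unordered_sum _ _) => x1 x2 x3 x4.
  move=> h1 h2.
  rewrite (_ : _ - _ = (x2 - x1 - c * (cont_part F v - cont_part F u)) +
     (x4 - c * (disc_part F v - disc_part F u))); last by ring.
  by rewrite (le_trans (ler_normD _ _))//; lra.
have limit : `|c * (F v - F u) - c * \sum_(hit_index (P n) u <= i < hit_index (P n) v) w n i|
    @[n --> \oo] --> (0 : R).
  rewrite -[X in _ --> X](normr0 R); apply: cvg_norm.
  rewrite -[X in _ --> X](subrr (c * (F v - F u))); apply: cvgB; first exact: cvg_cst.
  apply: cvgMr; rewrite (_ : F v - F u = (F v - F 0) - (F u - F 0)); last by ring.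
  rewrite -(funext WE); apply: cvgB; exact: wF'.
near=> n.
have small : `|c * (F v - F u) -
    c * \sum_(hit_index (P n) u <= i < hit_index (P n) v) w n i| <= eta.
  by apply/ltW; near: n; exact: cvgr_lt limit _ eta0.
rewrite BE mulrDr; have := sum_side n; move: int_side small.
set a := (c * \sum_(_ <= i < _) _).
set bb := e * \sum_(_ <= i < _) _ => h1 h2 h3.
have tri1 := ler_distD a (S n v - S n u) (I v - I u).
have tri2 := ler_distD (c * (F v - F u)) a (I v - I u).
move: h1 h2 h3 tri1 tri2; rewrite (distrC (I v - I u)) (distrC a (_ * _)).
by lra.
Unshelve. all: by end_near. Qed.

End finite_variation_integral.

(** * Quadratic variation and covariation *)

Section left_limit_algebra.
Context {R : realType}.
Implicit Types F G : R -> R.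

Lemma cadlagD F G : cadlag F -> cadlag G -> cadlag (F \+ G).
Proof.
move=> [rF lF] [rG lG]; split => t t0; first by apply: cvgD; [exact: rF|exact: rG].
by apply: is_cvgD; [exact: lF|exact: lG].
Qed.

Lemma cadlagZ c F : cadlag F -> cadlag (fun t => c * F t).
Proof.
move=> [rF lF]; split => t t0; first by apply: cvgMr; exact: rF.
by apply: is_cvgMr; exact: lF.
Qed.

Lemma jumpD F G s : cadlag F -> cadlag G -> 0 < s ->
  jump (F \+ G) s = jump F s + jump G s.
Proof.
move=> cF cG s0; rewrite /jump (left_lim_eq (l := left_lim F s + left_lim G s))//=.
  by ring.
by apply: cvgD; exact: left_lim_cvg.
Qed.

Lemma jumpZ c F s : cadlag F -> 0 < s -> jump (fun t => c * F t) s = c * jump F s.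
Proof.
move=> cF s0; rewrite /jump (left_lim_eq (l := c * left_lim F s))//=; first by ring.
by apply: cvgMr; exact: left_lim_cvg.
Qed.

End left_limit_algebra.

Section increments.
Context {R : realType}.
Implicit Types (p : time_partition R) (x A V : R -> R).

Definition incr p (t : R) x (i : nat) : R :=
  x (Num.min (p i.+1) t) - x (Num.min (p i) t).

Lemma incr_vanish p t x i : t <= p i -> incr p t x i = 0.
Proof.
move=> tp; rewrite /incr !min_r ?subrr//.
by rewrite (le_trans tp)// ltW// time_lt.
Qed.

Lemma sum_incr p t x m : 0 <= t ->
  \sum_(0 <= i < m) incr p t x i = x (Num.min (p m) t) - x 0.
Proof.
move=> t0; rewrite (telescope_sumr (fun i => x (Num.min (p i) t)))//.
by rewrite time0 (min_l t0).
Qed.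

Lemma incr_controls V A p t i : controls V A -> 0 <= t ->
  `|incr p t A i| <= incr p t V i.
Proof.
move=> cVA t0; apply: cVA; first by rewrite le_min time_ge0 t0.
by rewrite le_min !ge_min lexx orbT andbT (ltW (time_lt p i)).
Qed.

End increments.

Section quadratic_variation_sums.
Context {R : realType}.
Variable P : nat -> time_partition R.
Hypothesis hP : mesh_vanishes P.
Implicit Types (x y A : R -> R).

Lemma qv_sumE x (t : R) n :
  qv_sum P x t n = \sum_(0 <= i < hit_index (P n) t) incr (P n) t x i ^+ 2.
Proof.
rewrite /qv_sum (@limn_series_hit _ (P n) t)// => i ti.
by rewrite -/(incr (P n) t x i) incr_vanish// expr0n.
Qed.

Lemma qv_sum_double x (t : R) n : qv_sum P (x \+ x) t n = 4 * qv_sum P x t n.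
Proof.
rewrite !qv_sumE mulr_sumr; apply: eq_bigr => i _.
by rewrite /incr/=; ring.
Qed.

Lemma quad_var0 x : quad_var P x 0 = 0.
Proof.
rewrite /quad_var (_ : qv_sum P x 0 = fun=> 0) ?lim_cst//.
by apply/funext => n; rewrite qv_sumE hit_index0 big_geq.
Qed.

Lemma quad_var_half x (t : R) : cvgn (qv_sum P (x \+ x) t) ->
  quad_var P x t = 4^-1 * quad_var P (x \+ x) t.
Proof.
move=> cx; rewrite /quad_var; apply/cvg_lim => //.
rewrite (_ : qv_sum P x t = fun n => 4^-1 * qv_sum P (x \+ x) t n).
  exact: cvgMr.
by apply/funext => n; rewrite qv_sum_double; field.
Qed.

(** The case i = j of the definition for vectors concerns twice the path. *)
Lemma has_quad_var_half x : cadlag x -> has_quad_var P (x \+ x) -> has_quad_var P x.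
Proof.
move=> cx [_ cqv clq nd jq].
have qE (t : R) : 0 <= t -> quad_var P x t = 4^-1 * quad_var P (x \+ x) t.
  by move=> t0; apply: quad_var_half; exact: cqv.
have cl4 := cadlagZ 4^-1 clq.
have nearE (t : R) : 0 < t -> {near t^'-, (fun s => 4^-1 * quad_var P (x \+ x) s) =1 quad_var P x}.
  move=> t0; near=> s; rewrite qE//; apply/ltW; near: s; exact: nbhs_left_gt.
have left_cvg (t : R) : 0 < t -> quad_var P x s @[s --> t^'-] -->
    left_lim (fun s => 4^-1 * quad_var P (x \+ x) s) t.
  move=> t0; apply: cvg_trans (left_lim_cvg cl4 t0).
  by apply: near_eq_cvg; exact: nearE.
split.
- exact: cx.
- move=> t t0; rewrite (_ : qv_sum P x t = fun n => 4^-1 * qv_sum P (x \+ x) t n).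
    by apply: is_cvgMr; exact: cqv.
  by apply/funext => n; rewrite qv_sum_double; field.
- split => t t0; last by apply/cvg_ex; eexists; exact: left_cvg.
  rewrite qE//; apply: cvg_trans (cl4.1 t t0); apply: near_eq_cvg; near=> s.
  by rewrite qE// (le_trans t0)//; near: s; exact: nbhs_right_ge.
- move=> s t; rewrite !in_itv/= !andbT => s0 t0 st; rewrite !qE// ler_pM2l ?invr_gt0//.
  by apply: nd => //; rewrite in_itv/= andbT.
- move=> t; rewrite le_eqVlt => /predU1P[<-|t0].
    by rewrite /jump /left_lim lexx !subrr expr0n.
  have := jq t (ltW t0); rewrite jumpD// => jE.
  rewrite /jump (left_lim_eq t0 (left_cvg t t0)) qE; last exact: ltW.
  transitivity (jump (fun s => 4^-1 * quad_var P (x \+ x) s) t); first by [].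
  by rewrite jumpZ// jE -/(jump x t); field.
Unshelve. all: by end_near. Qed.

(** Increments frozen at t and increments frozen at v differ, before v, only
    in the cell that contains v, where both tend to the jump of x at v. *)
Lemma quad_sum_cvg x (t v : R) : has_quad_var P x -> 0 < v -> v <= t ->
  \sum_(0 <= i < hit_index (P n) v) incr (P n) t x i ^+ 2 @[n --> \oo] --> quad_var P x v.
Proof.
move=> [cx cqv _ _ _] v0 vt.
have t0 : 0 < t by exact: lt_le_trans vt.
pose a n := x (Num.min (P n (hit_index (P n) v)) t) - x (P n (hit_index (P n) v).-1).
pose b n := x v - x (P n (hit_index (P n) v).-1).
have E n : \sum_(0 <= i < hit_index (P n) v) incr (P n) t x i ^+ 2 =
    qv_sum P x v n + (a n ^+ 2 - b n ^+ 2).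
  rewrite qv_sumE -(hit_index_prednK (P n) v0) !big_nat_recr//=.
  rewrite /incr hit_index_prednK// -/(incr _ _ _ _).
  have lastv := time_pred_hit_index (P n) v0.
  rewrite (min_l (ltW lastv)) (min_l (ltW (lt_le_trans lastv vt))).
  rewrite (min_r (time_hit_index (P n) v)) -/(a n) -/(b n).
  rewrite [X in X + _](_ : _ = \sum_(0 <= i < (hit_index (P n) v).-1) incr (P n) v x i ^+ 2).
    by rewrite /incr; ring.
  rewrite big_nat_cond [RHS]big_nat_cond; apply: eq_bigr => i /andP[/andP[_ iv] _].
  have Pv : P n i.+1 <= v by rewrite ltW// hit_indexP -ltn_predRL.
  have Pv' : P n i <= v by rewrite (le_trans _ Pv)// ltW// time_lt.
  by rewrite /incr !min_l// (le_trans _ vt).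
rewrite (funext E) -[X in _ --> X]addr0; apply: cvgD; first by apply: cqv; exact: ltW.
have al : a n @[n --> \oo] --> x v - left_lim x v.
  by apply: cvgB; [exact: right_cell_cvg | exact: left_cell_cvg].
have bl : b n @[n --> \oo] --> x v - left_lim x v.
  by apply: cvgB; [exact: cvg_cst | exact: left_cell_cvg].
rewrite -[X in _ --> X](subrr ((x v - left_lim x v) ^+ 2)).
under eq_fun do rewrite !expr2; rewrite expr2.
by apply: cvgB; apply: cvgM.
Qed.

Section covariation.
Variables (x y : R -> R).
Hypotheses (qx : has_quad_var P x) (qy : has_quad_var P y).
Hypothesis qxy : has_quad_var P (x \+ y).

Let nd_controls z : has_quad_var P z -> controls (quad_var P z) (quad_var P z).
Proof.
move=> [_ _ _ nd _] u v u0 uv; rewrite ger0_norm ?subr_ge0//.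
by apply: nd => //; rewrite in_itv/= andbT// (le_trans u0).
Qed.

Let covarE : covar P x y = (fun t => 2^-1 * quad_var P (x \+ y) t) \+
  ((fun t => (- 2^-1) * quad_var P x t) \+ (fun t => (- 2^-1) * quad_var P y t)).
Proof. by apply/funext => t; rewrite /covar/=; ring. Qed.

(** A covariation is a combination of three nondecreasing functions. *)
Lemma covar_FV : FV_loc (covar P x y).
Proof.
rewrite covarE; apply: controls_FV.
  by apply: controlsD; [|apply: controlsD]; apply: controlsZ; exact: nd_controls.
case: qx qy qxy => [_ _ cx _ _] [_ _ cy _ _] [_ _ cxy _ _].
by move=> t t0; apply: cvgD; [|apply: cvgD];
  apply: cvgMr; [exact: cxy.1|exact: cx.1|exact: cy.1].
Qed.

Lemma jump_covar s : 0 < s -> jump (covar P x y) s = jump x s * jump y s.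
Proof.
move=> s0; rewrite covarE.
case: qx qy qxy => [cx _ cqx _ jx] [cy _ cqy _ jy] [_ _ cxy _ jxy].
have c1 := cadlagZ 2^-1 cxy.
have c2 := cadlagZ (- 2^-1) cqx.
have c3 := cadlagZ (- 2^-1) cqy.
rewrite (jumpD c1 (cadlagD c2 c3) s0) (jumpD c2 c3 s0).
rewrite (jumpZ _ cxy s0) (jumpZ _ cqx s0) (jumpZ _ cqy s0).
rewrite (jxy _ (ltW s0)) (jx _ (ltW s0)) (jy _ (ltW s0)) (jumpD cx cy s0).
by field.
Qed.

Lemma covar_sum_cvg (t v : R) : 0 < v -> v <= t ->
  \sum_(0 <= i < hit_index (P n) v) incr (P n) t x i * incr (P n) t y i @[n --> \oo] -->
  covar P x y v - covar P x y 0.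
Proof.
move=> v0 vt; rewrite {2}/covar !quad_var0 !subr0 mulr0 subr0 /covar.
have E n : \sum_(0 <= i < hit_index (P n) v) incr (P n) t x i * incr (P n) t y i =
    2^-1 * (\sum_(0 <= i < hit_index (P n) v) incr (P n) t (x \+ y) i ^+ 2
     - \sum_(0 <= i < hit_index (P n) v) incr (P n) t x i ^+ 2
     - \sum_(0 <= i < hit_index (P n) v) incr (P n) t y i ^+ 2).
  rewrite -!sumrB mulr_sumr; apply: eq_bigr => i _.
  by rewrite /incr/=; field.
rewrite (funext E); apply: cvgMr; apply: cvgB; [apply: cvgB|]; exact: quad_sum_cvg.
Qed.

Lemma riemann_sum_covar (phi : R -> R) (t : R) : 0 <= t -> cadlag phi ->
  \sum_(0 <= i < hit_index (P n) t)
     phi (P n i) * (incr (P n) t x i * incr (P n) t y i) @[n --> \oo] -->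
    fv_int (cont_part (covar P x y)) (left_lim phi) t +
    unordered_sum `]0, t] (fun s => left_lim phi s * (jump x s * jump y s)).
Proof.
move=> t0 cphi.
rewrite (@eq_unordered_sum _ _ _ (fun s => left_lim phi s * jump (covar P x y) s)); last first.
  by move=> s; rewrite /= in_itv/= => /andP[s0 _]; rewrite jump_covar.
pose b n i := incr (P n) t x i ^+ 2 + incr (P n) t y i ^+ 2.
apply: (riemann_sum_FV hP (w := fun n i => incr (P n) t x i * incr (P n) t y i)
  (b := b) (C := quad_var P x t + quad_var P y t + 1)) => //.
- exact: covar_FV.
- move=> n i; rewrite /b ler_norml; apply/andP; split; nra.
- move: t0; rewrite le_eqVlt => /predU1P[<-|t0].
    near=> n; rewrite hit_index0 big_geq// !quad_var0; lra.
  have : \sum_(0 <= i < hit_index (P n) t) b n i @[n --> \oo] --> quad_var P x t + quad_var P y t.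
    under eq_fun do rewrite big_split/=.
    by apply: cvgD; exact: quad_sum_cvg.
  move=> /cvgr_le; apply; by rewrite ltrDl.
- by move=> v v0 vt; exact: covar_sum_cvg.
Unshelve. all: by end_near. Qed.

End covariation.

Lemma riemann_sum_path A (phi : R -> R) (t : R) : 0 <= t -> FV_loc A -> cadlag phi ->
  \sum_(0 <= i < hit_index (P n) t) phi (P n i) * incr (P n) t A i @[n --> \oo] -->
    fv_int (cont_part A) (left_lim phi) t +
    unordered_sum `]0, t] (fun s => left_lim phi s * jump A s).
Proof.
move=> t0 fA cphi; have [cA _] := fA; have cVA := tot_var_controls fA.
apply: (riemann_sum_FV hP (w := fun n => incr (P n) t A)
  (b := fun n => incr (P n) t (tot_var A)) (C := tot_var A t - tot_var A 0)) => //.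
- by move=> n i; exact: incr_controls.
- near=> n; rewrite sum_incr// lerD2r (controls_nd cVA)//.
    by rewrite le_min time_ge0.
  by rewrite ge_min lexx orbT.
- move=> v v0 vt; under eq_fun do rewrite sum_incr//.
  by apply: cvgB; [exact: right_cell_cvg|exact: cvg_cst].
Unshelve. all: by end_near. Qed.

End quadratic_variation_sums.

(** * Taylor estimates from partial derivatives *)

Section row_vectors.
Context {R : realType} {n : nat}.
Implicit Types v : 'rV[R]_n.

Lemma coord_le_norm v k : `|v 0 k| <= `|v|.
Proof. by rewrite [leRHS]mx_normrE; exact: (le_bigmax _ (fun ij => `|v ij.1 ij.2|) (0, k)). Qed.

Lemma norm_le_coord v (M : R) : 0 <= M -> (forall k, `|v 0 k| <= M) -> `|v| <= M.
Proof.
move=> M0 vM; rewrite [leLHS]mx_normrE; apply: bigmax_le => // -[i j] _ /=.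
by rewrite ord1.
Qed.

Definition norm1 v : R := \sum_(k < n) `|v 0 k|.

Lemma norm1_ge0 v : 0 <= norm1 v.
Proof. by apply: sumr_ge0. Qed.

Lemma norm1Z s v : norm1 (s *: v) = `|s| * norm1 v.
Proof. by rewrite /norm1 mulr_sumr; apply: eq_bigr => k _; rewrite mxE normrM. Qed.

End row_vectors.

Section taylor.
Context {R : realType}.

Lemma segment_mvt (p p' : R -> R) (a K : R) :
  (forall s : R, is_derive s 1 p (p' s)) -> (forall s, `|s| <= `|a| -> `|p' s| <= K) ->
  `|p a - p 0| <= K * `|a|.
Proof.
move=> dp pK.
have cp (i : interval R) : {within [set` i], continuous p}.
  by apply: derivable_within_continuous => s _; have [] := dp s.
have [a0|a0] := leP 0 a.
  have [s] := MVT_segment a0 (fun s _ => dp s) (cp _).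
  rewrite in_itv/= => /andP[s0 sa] ->; rewrite subr0 normrM ler_wpM2r//.
  by apply: pK; rewrite !ger0_norm.
have [s] := MVT_segment (ltW a0) (fun s _ => dp s) (cp _).
rewrite in_itv/= => /andP[sa s0] E.
rewrite distrC E sub0r normrM normrN ler_wpM2r//.
by apply: pK; rewrite (ler0_norm s0) (ltr0_norm a0) lerN2.
Qed.

Lemma is_derive_line (V : normedModType R) (g : V -> R) (y v : V) (s dg : R) :
  is_derive (y + s *: v) v g dg -> is_derive s 1 (fun s => g (y + s *: v)) dg.
Proof.
move=> [dgv dgE].
have E : (fun h : R => h^-1 *: (g (y + (h *: (1 : R) + s) *: v) - g (y + s *: v))) =
         (fun h : R => h^-1 *: (g (h *: v + (y + s *: v)) - g (y + s *: v))).
  apply/funext => h; congr (_ *: (g _ - _)).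
  by rewrite -[h *: 1]/(h * 1) mulr1 scalerDl addrCA.
split; first by rewrite /derivable E.
by rewrite -dgE /derive E.
Qed.

Section first_order.
Context {n : nat}.
Implicit Types (g : 'rV[R]_n -> R) (x h : 'rV[R]_n).

Let e_ (k : 'I_n) : 'rV[R]_n := delta_mx 0 k.

(** Go from x to x + h one coordinate at a time and apply the mean value
    theorem to each move. In the supremum norm all the points met are within
    |h| of x. *)
Lemma c1_estimate g x h (c : 'I_n -> R) (w : R) :
  (forall k y, derivable g y (e_ k)) ->
  (forall k y, `|y - x| <= `|h| -> `|'D_(e_ k) g y - c k| <= w) ->
  `|g (x + h) - g x - \sum_k c k * h 0 k| <= w * norm1 h.
Proof.
move=> dg gc.
pose trunc (j : nat) : 'rV[R]_n := \row_k (if (k < j)%N then h 0 k else 0).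
have step (k : 'I_n) : trunc k.+1 = trunc k + h 0 k *: e_ k.
  apply/rowP => l; rewrite !mxE eqxx/= ltnS leq_eqVlt val_eqE.
  by have [->|_] := eqVneq l k; rewrite ?ltnn ?mulr1 ?add0r ?mulr0 ?addr0.
have tele : g (x + h) - g x =
    \sum_(k < n) (g (x + trunc k.+1) - g (x + trunc k)).
  rewrite -(big_mkord xpredT (fun k => g (x + trunc k.+1) - g (x + trunc k))).
  rewrite (telescope_sumr (fun k => g (x + trunc k)))//.
  have -> : trunc n = h by apply/rowP => k; rewrite mxE ltn_ord.
  by have -> : trunc 0%N = 0; [apply/rowP => k; rewrite !mxE | rewrite addr0].
rewrite tele -sumrB (le_trans (ler_norm_sum _ _ _))//.
rewrite /norm1 mulr_sumr; apply: ler_sum => k _.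
pose p s := g (x + trunc k + s *: e_ k) - c k * s.
have -> : g (x + trunc k.+1) - g (x + trunc k) - c k * h 0 k = p (h 0 k) - p 0.
  by rewrite /p step addrA scale0r addr0; ring.
apply: (@segment_mvt p (fun s => 'D_(e_ k) g (x + trunc k + s *: e_ k) - c k)).
  move=> s; apply: is_deriveB; first by apply: is_derive_line; exact: derivableP.
  by apply: is_derive_eq; rewrite /GRing.scale/= mulr1.
move=> s sh; apply: gc.
rewrite -(addrA x) [x + _]addrC addrK; apply: norm_le_coord => // l.
rewrite !mxE eqxx/=.
have [->|lk] := eqVneq l k.
  by rewrite ltnn mulr1 add0r (le_trans sh)// coord_le_norm.
rewrite mulr0 addr0; case: ifP => _; first exact: coord_le_norm.
by rewrite normr0.
Qed.

(** By [c1_estimate] along s h: by continuity the partial derivatives are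
    nearly constant on a small ball around y. *)
Lemma is_derive_total g y h :
  (forall k z, derivable g z (e_ k)) ->
  (forall k, {for y, continuous ('D_(e_ k) g)}) ->
  is_derive y h g (\sum_k 'D_(e_ k) g y * h 0 k).
Proof.
move=> dg cg.
suff cv : s^-1 *: (g (s *: h + y) - g y) @[s --> 0^'] --> \sum_k 'D_(e_ k) g y * h 0 k.
  by split; [apply/cvg_ex; eexists; exact: cv | exact/cvg_lim].
apply/cvgrPdist_le => e e0.
have N1 : 0 < norm1 h + 1 by rewrite ltr_wpDl ?norm1_ge0.
have w0 : 0 < e / (norm1 h + 1) by rewrite divr_gt0.
have : \forall z \near y, forall k, `|'D_(e_ k) g z - 'D_(e_ k) g y| <= e / (norm1 h + 1).
  apply: (@filter_forall _ _ (fun k z => `|'D_(e_ k) g z - 'D_(e_ k) g y| <= e / (norm1 h + 1))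
    (nbhs y) (nbhs_filter y)) => k.
  have ck : 'D_(e_ k) g z @[z --> y] --> 'D_(e_ k) g y by exact: cg.
  have /cvgrPdist_le/(_ _ w0) := ck.
  by apply: filterS => z; rewrite distrC.
move=> /nbhs_ballP[r /= r0 rP].
have h1 : 0 < `|h| + 1 by rewrite ltr_wpDl.
near=> s.
have s0 : s != 0 by near: s; exact: nbhs_dnbhs_neq.
have sr : `|s| < r / (`|h| + 1).
  near: s; apply: dnbhs0_lt; exact: divr_gt0.
have est : `|g (y + s *: h) - g y - \sum_k 'D_(e_ k) g y * (s *: h) 0 k| <=
    e / (norm1 h + 1) * norm1 (s *: h).
  apply: c1_estimate => // k z zy; apply: rP; rewrite -ball_normE /= distrC.
  rewrite (le_lt_trans zy)// normrZ.
  move: sr; rewrite ltr_pdivlMr// => /(le_lt_trans _); apply.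
  by rewrite ler_wpM2l// lerDl.
rewrite distrC (addrC _ y).
have -> : s^-1 *: (g (y + s *: h) - g y) - \sum_k 'D_(e_ k) g y * h 0 k =
    s^-1 * (g (y + s *: h) - g y - \sum_k 'D_(e_ k) g y * (s *: h) 0 k).
  rewrite [in RHS]mulrBr; congr (_ - _); rewrite mulr_sumr.
  by apply: eq_bigr => k _; rewrite mxE mulrCA mulKf.
rewrite normrM normfV mulrC ler_pdivrMr ?normr_gt0// (le_trans est)// norm1Z.
rewrite mulrCA [leRHS]mulrC ler_wpM2l//.
by rewrite mulrAC ler_pdivrMr// ler_pM2l// lerDl.
Unshelve. all: by end_near. Qed.

(** The mean value theorem for s |-> g (x + s h) minus its quadratic Taylor
    polynomial. The derivative is a combination of the first order remainders of
    the partial derivatives of g, which [c1_estimate] bounds. *)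
Lemma c2_estimate g x h (w : R) :
  (forall k z, derivable g z (e_ k)) ->
  (forall l k z, derivable ('D_(e_ l) g) z (e_ k)) ->
  (forall k, continuous ('D_(e_ k) g)) ->
  (forall k l y, `|y - x| <= `|h| ->
     `|'D_(e_ k) ('D_(e_ l) g) y - 'D_(e_ k) ('D_(e_ l) g) x| <= w) ->
  `|g (x + h) - g x - \sum_l 'D_(e_ l) g x * h 0 l
     - 2^-1 * \sum_k \sum_l 'D_(e_ k) ('D_(e_ l) g) x * (h 0 k * h 0 l)|
    <= w * norm1 h ^+ 2.
Proof.
move=> dg ddg cdg gw.
pose L := \sum_l 'D_(e_ l) g x * h 0 l.
pose Q := \sum_k \sum_l 'D_(e_ k) ('D_(e_ l) g) x * (h 0 k * h 0 l).
pose p (s : R) := g (x + s *: h) - (L * s + 2^-1 * Q * s ^+ 2).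
pose p' s := \sum_l 'D_(e_ l) g (x + s *: h) * h 0 l - (L + Q * s).
have -> : g (x + h) - g x - L - 2^-1 * Q = p 1 - p 0.
  by rewrite /p scale1r scale0r addr0; ring.
rewrite -[leRHS]mulr1 -[X in _ <= _ * X](normr1 R).
apply: (@segment_mvt p p').
  move=> s; apply: is_deriveB.
    by apply: is_derive_line; apply: is_derive_total => // k; exact: cdg.
  by apply: is_derive_eq; rewrite /GRing.scale/=; field.
rewrite normr1 => s s1.
have est l : `|'D_(e_ l) g (x + s *: h) - 'D_(e_ l) g x -
    \sum_k 'D_(e_ k) ('D_(e_ l) g) x * (s *: h) 0 k| <= w * norm1 (s *: h).
  apply: (c1_estimate (ddg l)) => k y ys; apply: gw; rewrite (le_trans ys)//.
  by rewrite normrZ ler_piMl.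
have -> : p' s = \sum_l ('D_(e_ l) g (x + s *: h) - 'D_(e_ l) g x -
    \sum_k 'D_(e_ k) ('D_(e_ l) g) x * (s *: h) 0 k) * h 0 l.
  under eq_bigr do rewrite !mulrBl; rewrite !sumrB /p' opprD addrA; congr (_ - _ - _).
  rewrite /Q exchange_big mulr_suml; apply: eq_bigr => l _.
  rewrite !mulr_suml; apply: eq_bigr => k _; rewrite mxE; ring.
rewrite (le_trans (ler_norm_sum _ _ _))// expr2 mulrA [in leRHS]/norm1 mulr_sumr.
apply: ler_sum => l _; rewrite normrM ler_wpM2r// (le_trans (est l))//.
have w0 : 0 <= w.
  by rewrite (le_trans (normr_ge0 _) (gw l l x _))// subrr normr0.
by rewrite ler_wpM2l// norm1Z ler_piMl// norm1_ge0.
Qed.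

End first_order.
End taylor.

(** * The mixed Taylor remainder *)

Section convergence_of_vectors.
Context {R : realType}.

Lemma cvg_sumr {T : Type} {F : set_system T} {FF : Filter F} (n : nat)
    (u : 'I_n -> T -> R) (l : 'I_n -> R) :
  (forall k, u k x @[x --> F] --> l k) ->
  \sum_(k < n) u k x @[x --> F] --> \sum_(k < n) l k.
Proof.
move=> ul; elim: (index_enum _) => [|k r IH].
  by under eq_fun do rewrite big_nil; rewrite big_nil; exact: cvg_cst.
by under eq_fun do rewrite big_cons; rewrite big_cons; exact: cvgD.
Qed.

Lemma cvg_coord {T : Type} {F : set_system T} {FF : Filter F} (n : nat)
    (u : T -> 'rV[R]_n) (l : 'rV[R]_n) k :
  u x @[x --> F] --> l -> u x 0 k @[x --> F] --> l 0 k.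
Proof.
move=> ul; apply: (@continuous_cvg _ _ _ F FF u (fun v : 'rV[R]_n => v 0 k)) => //.
exact: coord_continuous.
Qed.

Lemma cvg_row {T : Type} {F : set_system T} {FF : Filter F} (n : nat)
    (u : T -> 'rV[R]_n) (l : 'rV[R]_n) :
  (forall k, u x 0 k @[x --> F] --> l 0 k) -> u x @[x --> F] --> l.
Proof.
move=> ul; apply/cvgrPdist_le => e e0.
have : \forall x \near F, forall k, `|l 0 k - u x 0 k| <= e.
  apply: (@filter_forall _ _ (fun k x => `|l 0 k - u x 0 k| <= e)) => k.
  by have /cvgrPdist_le/(_ _ e0) := ul k.
apply: filterS => x H; apply: norm_le_coord; first exact: ltW.
by move=> k; rewrite !mxE.
Qed.

Lemma cvg_norm1 {T : Type} {F : set_system T} {FF : Filter F} (n : nat)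
    (u : T -> 'rV[R]_n) (l : 'rV[R]_n) :
  u x @[x --> F] --> l -> norm1 (u x) @[x --> F] --> norm1 l.
Proof.
by move=> ul; apply: cvg_sumr => k; apply: cvg_norm; exact: cvg_coord.
Qed.

Lemma cvg_jointly {T : Type} {F : set_system T} {FF : Filter F} (m d : nat)
    (g : 'rV[R]_m -> 'rV[R]_d -> R) (u : T -> 'rV[R]_m) (v : T -> 'rV[R]_d) a x :
  jointly_continuous g -> u s @[s --> F] --> a -> v s @[s --> F] --> x ->
  g (u s) (v s) @[s --> F] --> g a x.
Proof. 
by move=> cg ua vx; apply: (@continuous2_cvg _ _ _ _ F FF u v g a x) => //; exact: (cg (a, x)).
Qed.

Lemma jointly_continuous_r (m d : nat) (g : 'rV[R]_m -> 'rV[R]_d -> R) a :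
  jointly_continuous g -> continuous (g a).
Proof. 
move=> cg.
suff H (y : 'rV[R]_d) : g a xi @[xi --> y] --> g a y by move=> y; exact: H.
have ca : (fun _ : 'rV[R]_d => a) xi @[xi --> y] --> a.
  exact: (@cvg_cst _ a _ (nbhs y) (nbhs_filter y)).
exact: (@cvg_jointly _ (nbhs y) (nbhs_filter y) _ _ _ _ _ _ _ cg ca (@cvg_id _ _)).
Qed.

End convergence_of_vectors.

Section second_order_remainder.
Context {R : realType} {m d : nat}.
Variable f : 'rV[R]_m -> 'rV[R]_d -> R.
Hypothesis hf : C12 f.

Definition taylor_part (a : 'rV[R]_m) (x : 'rV[R]_d) (da : 'rV[R]_m) (dx : 'rV[R]_d) : R :=
  \sum_(k < m) partial_a f k a x * da 0 k +
  \sum_(k < d) partial_x f k a x * dx 0 k +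
  2^-1 * \sum_(k < d) \sum_(l < d) partial_xx f k l a x * (dx 0 k * dx 0 l).

Definition taylor_rem (a : 'rV[R]_m) (x : 'rV[R]_d) a' x' : R :=
  f a' x' - f a x - taylor_part a x (a' - a) (x' - x).

(** The size of the remainder: first order in a, along which the path has
    finite variation, and second order in x, along which it has quadratic
    variation. *)
Definition weight (da : 'rV[R]_m) (dx : 'rV[R]_d) : R := norm1 da + norm1 dx ^+ 2.

Lemma weight_ge0 da dx : 0 <= weight da dx.
Proof. by rewrite addr_ge0 ?norm1_ge0// exprn_ge0 ?norm1_ge0. Qed.

(** Move a first, to first order and with x' already in place, and then x, to
    second order with a fixed. *)
Lemma taylor_rem_le a x a' x' (w : R) :
  (forall k al, `|al - a| <= `|a' - a| ->
    `|partial_a f k al x' - partial_a f k a x| <= w) ->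
  (forall k l xi, `|xi - x| <= `|x' - x| ->
    `|partial_xx f k l a xi - partial_xx f k l a x| <= w) ->
  `|taylor_rem a x a' x'| <= w * weight (a' - a) (x' - x).
Proof.
have [[da dx dxx] [_ cx _]] := hf => fa fxx.
have cxa k : continuous ('D_(delta_mx 0 k) (f a)).
  exact: (@jointly_continuous_r _ _ _ (partial_x f k) a (cx k)).
have H1 := @c1_estimate R m (f ^~ x') a (a' - a) (fun k => partial_a f k a x) w
  (fun k y => da k y x') fa.
have H2 := @c2_estimate R d (f a) x (x' - x) w (fun k => dx k a) (fun l k => dxx k l a)
  cxa fxx.
rewrite !(addrC _ (_ - _)) !subrK in H1 H2.
rewrite /taylor_rem /taylor_part /weight mulrDr.
rewrite (_ : f a' x' - f a x - _ =
  (f a' x' - f a x' - \sum_(k < m) partial_a f k a x * (a' - a) 0 k) +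
  (f a x' - f a x - \sum_(k < d) partial_x f k a x * (x' - x) 0 k -
   2^-1 * \sum_(k < d) \sum_(l < d) partial_xx f k l a x * ((x' - x) 0 k * (x' - x) 0 l)));
  last by ring.
apply: (le_trans (ler_normD _ _)); apply: lerD; first exact: H1.
exact: H2.
Qed.

(** By continuity the derivatives involved oscillate by at most e on a ball.
    Since the intermediate points of Taylor's formula lie within |a' - a| of a,
    a quarter of its radius keeps them inside. *)
Lemma taylor_rem_local a0 x0 (e : R) : 0 < e -> exists2 r, 0 < r &
  forall a x a' x', `|a - a0| <= r -> `|x - x0| <= r ->
    `|a' - a0| <= r -> `|x' - x0| <= r ->
    `|taylor_rem a x a' x'| <= e * weight (a' - a) (x' - x).
Proof.
move=> e0; have [_ [ca _ cxx]] := hf.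
have e2 : 0 < e / 2 by rewrite divr_gt0.
pose near0 (g : 'rV[R]_m -> 'rV[R]_d -> R) (p : 'rV[R]_m * 'rV[R]_d) :=
  `|g p.1 p.2 - g a0 x0| <= e / 2.
have nearg g : jointly_continuous g -> \forall p \near (a0, x0), near0 g p.
  move=> cg.
  have cg0 : g p.1 p.2 @[p --> (a0, x0)] --> g a0 x0 by exact: (cg (a0, x0)).
  have /cvgrPdist_le/(_ _ e2) := cg0.
  by apply: filterS => p; rewrite /near0 distrC.
have Na : \forall p \near (a0, x0), forall k, near0 (partial_a f k) p.
  by apply: (@filter_forall _ _ (fun k p => near0 (partial_a f k) p)
    (nbhs (a0, x0)) (nbhs_filter _)) => k; exact: nearg.
have Nx : \forall p \near (a0, x0), forall kl : 'I_d * 'I_d, near0 (partial_xx f kl.1 kl.2) p.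
  by apply: (@filter_forall _ _ (fun kl p => near0 (partial_xx f kl.1 kl.2) p)
    (nbhs (a0, x0)) (nbhs_filter _)) => kl; exact: nearg.
have /nbhs_ballP[r /= r0 rP] : \forall p \near (a0, x0),
    (forall k, near0 (partial_a f k) p) /\ (forall kl, near0 (partial_xx f kl.1 kl.2) p).
  exact: filterI Na Nx.
have ball_r a x : `|a - a0| < r -> `|x - x0| < r -> ball (a0, x0) r (a, x).
  by move=> ha hx; split => /=; rewrite -ball_normE /= distrC.
have r4 : 0 < r / 4 by rewrite divr_gt0.
exists (r / 4) => // a x a' x' ha hx ha' hx'.
have close g p q : near0 g p -> near0 g q -> `|g p.1 p.2 - g q.1 q.2| <= e.
  rewrite /near0 => hp hq.
  rewrite (le_trans (ler_distD (g a0 x0) _ _))// (distrC (g a0 x0)).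
  by rewrite (splitr e) lerD.
have [ra rx] : ball (a0, x0) r (a, x) /\ true by split => //; apply: ball_r; lra.
have dist_r n (b b' b0 y : 'rV[R]_n) : `|b - b0| <= r / 4 -> `|b' - b0| <= r / 4 ->
    `|y - b| <= `|b' - b| -> `|y - b0| < r.
  move=> h1 h2 h3; rewrite (le_lt_trans (ler_distD b _ _))//.
  have := ler_distD b0 b' b; rewrite (distrC b0) => h4; lra.
apply: taylor_rem_le.
- move=> k al hal; apply: (close _ (al, x') (a, x)).
    by apply: (rP (al, x') _).1; apply: ball_r; [exact: dist_r hal|lra].
  exact: (rP (a, x) ra).1.
- move=> k l xi hxi; apply: (close _ (a, xi) (a, x)).
    by apply: ((rP (a, xi) _).2 (k, l)); apply: ball_r; [lra|exact: dist_r hxi].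
  exact: ((rP (a, x) ra).2 (k, l)).
Qed.

Lemma taylor_rem0 a x : taylor_rem a x a x = 0.
Proof.
rewrite /taylor_rem /taylor_part !subrr !sub0r.
rewrite !big1; first by rewrite mulr0 !addr0 oppr0.
- by move=> k _; rewrite big1// => l _; rewrite mxE mul0r mulr0.
- by move=> k _; rewrite mxE mulr0.
- by move=> k _; rewrite mxE mulr0.
Qed.

Lemma cvg_taylor_part {T : Type} {F : set_system T} {FF : Filter F}
    (a da : T -> 'rV[R]_m) (x dx : T -> 'rV[R]_d) a0 x0 da0 dx0 :
  a s @[s --> F] --> a0 -> x s @[s --> F] --> x0 ->
  da s @[s --> F] --> da0 -> dx s @[s --> F] --> dx0 ->
  taylor_part (a s) (x s) (da s) (dx s) @[s --> F] --> taylor_part a0 x0 da0 dx0.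
Proof.
move=> ha hx hda hdx; have [_ [ca cx cxx]] := hf.
apply: cvgD; first apply: cvgD.
- by apply: cvg_sumr => k; apply: cvgM; [exact: cvg_jointly|exact: cvg_coord].
- by apply: cvg_sumr => k; apply: cvgM; [exact: cvg_jointly|exact: cvg_coord].
- apply: cvgMr; apply: cvg_sumr => k; apply: cvg_sumr => l.
  apply: cvgM; first exact: cvg_jointly.
  by apply: cvgM; exact: cvg_coord.
Qed.

(** Taylor's formula at (a0, x0): its polynomial part and its remainder both
    tend to 0. *)
Lemma C12_continuous : jointly_continuous f.
Proof.
move=> [a0 x0] /=; have [r r0 rP] := taylor_rem_local a0 x0 ltr01.
have fst_cvg : p.1 @[p --> (a0, x0)] --> a0 by exact: cvg_fst.
have snd_cvg : p.2 @[p --> (a0, x0)] --> x0 by exact: cvg_snd.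
have da : p.1 - a0 @[p --> (a0, x0)] --> a0 - a0 by apply: cvgB; [|exact: cvg_cst].
have dx : p.2 - x0 @[p --> (a0, x0)] --> x0 - x0 by apply: cvgB; [|exact: cvg_cst].
have rem0 : taylor_rem a0 x0 p.1 p.2 @[p --> (a0, x0)] --> (0 : R).
  apply/cvgr0Pnorm_le => e e0.
  have wcv : weight (p.1 - a0) (p.2 - x0) @[p --> (a0, x0)] --> (0 : R).
    have -> : 0 = weight (a0 - a0) (x0 - x0) :> R.
      by rewrite /weight /norm1 !subrr !big1 ?expr0n ?addr0// => k _; rewrite mxE normr0.
    apply: cvgD; first exact: cvg_norm1.
    by under eq_fun do rewrite expr2; rewrite expr2; apply: cvgM; exact: cvg_norm1.
  near=> p.
  apply: (@le_trans _ _ (1 * weight (p.1 - a0) (p.2 - x0))).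
    apply: rP; rewrite ?subrr ?normr0 ?(ltW r0)//.
    + by near: p; have /cvgrPdist_le/(_ _ r0) := fst_cvg; apply: filterS => p; rewrite distrC.
    + by near: p; have /cvgrPdist_le/(_ _ r0) := snd_cvg; apply: filterS => p; rewrite distrC.
  rewrite mul1r (le_trans (ler_norm _))//; near: p.
  by have /cvgr0Pnorm_le/(_ _ e0) := wcv.
have tp : taylor_part a0 x0 (p.1 - a0) (p.2 - x0) @[p --> (a0, x0)] -->
    taylor_part a0 x0 (a0 - a0) (x0 - x0).
  apply: (@cvg_taylor_part _ _ (nbhs_filter (a0, x0))) => //; exact: cvg_cst.
have fE : (fun p : 'rV[R]_m * 'rV[R]_d => f p.1 p.2) = (fun p =>
    f a0 x0 + (taylor_rem a0 x0 p.1 p.2 + taylor_part a0 x0 (p.1 - a0) (p.2 - x0))).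
  by apply/funext => p; rewrite /taylor_rem; ring.
have E : f a0 x0 = f a0 x0 + (0 + taylor_part a0 x0 (a0 - a0) (x0 - x0)).
  have := taylor_rem0 a0 x0; rewrite /taylor_rem subrr => /eqP.
  by rewrite sub0r oppr_eq0 => /eqP ->; rewrite !addr0.
have H : f a0 x0 + (taylor_rem a0 x0 p.1 p.2 + taylor_part a0 x0 (p.1 - a0) (p.2 - x0))
    @[p --> (a0, x0)] --> f a0 x0 + (0 + taylor_part a0 x0 (a0 - a0) (x0 - x0)).
  by apply: cvgD; [exact: cvg_cst|exact: (cvgD rem0 tp)].
by rewrite -fE -E in H.
Unshelve. all: by end_near. Qed.

Lemma cvg_taylor_rem {T : Type} {F : set_system T} {FF : Filter F}
    (a a' : T -> 'rV[R]_m) (x x' : T -> 'rV[R]_d) a0 x0 a1 x1 :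
  a s @[s --> F] --> a0 -> x s @[s --> F] --> x0 ->
  a' s @[s --> F] --> a1 -> x' s @[s --> F] --> x1 ->
  taylor_rem (a s) (x s) (a' s) (x' s) @[s --> F] --> taylor_rem a0 x0 a1 x1.
Proof.
move=> ha hx ha' hx'; apply: cvgB; first apply: cvgB.
- by apply: cvg_jointly => //; exact: C12_continuous.
- by apply: cvg_jointly => //; exact: C12_continuous.
- by apply: cvg_taylor_part => //; exact: cvgB.
Qed.

End second_order_remainder.

(** * Convergence of the sums of remainders *)

Section vector_paths.
Context {R : realType}.

Lemma cadlag_coord (n : nat) (X : R -> 'rV[R]_n) k : cadlag X -> cadlag (path_coord X k).
Proof.
move=> [rX lX]; split => t t0.
  by apply: cvg_coord; exact: rX.
have /cvg_ex[l Xl] := lX t t0.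
by apply/cvg_ex; exists (l 0 k); exact: cvg_coord.
Qed.

Lemma cadlag_row (n : nat) (X : R -> 'rV[R]_n) :
  (forall k, cadlag (path_coord X k)) -> cadlag X.
Proof.
move=> cX; split => t t0; first by apply: cvg_row => k; exact: (cX k).1.
apply/cvg_ex; exists (\row_k left_lim (path_coord X k) t); apply: cvg_row => k.
by rewrite mxE; exact: (left_lim_cvg (cX k) t0).
Qed.

Lemma left_lim_coord (n : nat) (X : R -> 'rV[R]_n) k s : cadlag X ->
  left_lim (path_coord X k) s = left_lim X s 0 k.
Proof.
move=> cX; have [s0|s0] := leP s 0; first by rewrite /left_lim s0.
by apply: left_lim_eq => //; apply: cvg_coord; exact: left_lim_cvg.
Qed.

Lemma jump_coord (n : nat) (X : R -> 'rV[R]_n) k s : cadlag X ->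
  jump (path_coord X k) s = (X s - left_lim X s) 0 k.
Proof. by move=> cX; rewrite /jump left_lim_coord// !mxE. Qed.

Variables (m d : nat) (g : 'rV[R]_m -> 'rV[R]_d -> R).
Variables (A : R -> 'rV[R]_m) (X : R -> 'rV[R]_d).
Hypotheses (cg : jointly_continuous g) (cA : cadlag A) (cX : cadlag X).

Lemma cadlag_jointly : cadlag (fun s => g (A s) (X s)).
Proof.
split => t t0.
  by apply: cvg_jointly => //; [exact: cA.1|exact: cX.1].
apply/cvg_ex; exists (g (left_lim A t) (left_lim X t)).
by apply: cvg_jointly => //; exact: left_lim_cvg.
Qed.

Lemma left_lim_jointly :
  left_lim (fun s => g (A s) (X s)) = (fun s => g (left_lim A s) (left_lim X s)).
Proof.
apply/funext => s; have [s0|s0] := leP s 0; first by rewrite /left_lim s0.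
by apply: left_lim_eq => //; apply: cvg_jointly => //; exact: left_lim_cvg.
Qed.

End vector_paths.

Section norm1_square.
Context {R : realType}.

(** Double the product of two coordinates is at most the sum of their squares. *)
Lemma sqr_norm1_le (d : nat) (v : 'rV[R]_d) :
  norm1 v ^+ 2 <= d%:R * \sum_(k < d) v 0 k ^+ 2.
Proof.
rewrite expr2 {1}/norm1 mulr_suml.
have -> : d%:R * \sum_(k < d) v 0 k ^+ 2 =
    \sum_(k < d) \sum_(l < d) 2^-1 * (v 0 k ^+ 2 + v 0 l ^+ 2).
  under [RHS]eq_bigr do rewrite -mulr_sumr big_split/= sumr_const card_ord.
  rewrite -mulr_sumr big_split/= sumr_const card_ord sumrMnl -mulr_natl.
  by field.
apply: ler_sum => k _; rewrite /norm1 mulr_sumr; apply: ler_sum => l _.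
rewrite -(real_normK (num_real (v 0 k))) -(real_normK (num_real (v 0 l))).
by have := sqr_ge0 (`|v 0 k| - `|v 0 l|); nra.
Qed.

End norm1_square.

Section ito.
Context {R : realType} {m d : nat}.
Variable P : nat -> time_partition R.
Hypothesis hP : mesh_vanishes P.
Variables (X : R -> 'rV[R]_d) (A : R -> 'rV[R]_m).
Hypotheses (hX : QV P X) (hA : forall k : 'I_m, FV_loc (path_coord A k)).
Variable f : 'rV[R]_m -> 'rV[R]_d -> R.
Hypothesis hf : C12 f.

Let cX : cadlag X := hX.1.
Let cA : cadlag A. Proof. by apply: cadlag_row => k; case: (hA k). Qed.

Let qX k : has_quad_var P (path_coord X k).
Proof. by apply: has_quad_var_half; [exact: cadlag_coord | exact: hX.2]. Qed.

(** Its increments dominate the weights of the jumps, since a jump of A is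
    bounded by the variation and the square of a jump of X is a jump of the
    quadratic variation. *)
Let W s := \sum_(k < m) tot_var (path_coord A k) s +
  d%:R * \sum_(k < d) quad_var P (path_coord X k) s.

Let jumpR s := taylor_rem f (left_lim A s) (left_lim X s) (A s) (X s).

Let quad_nd k u v : 0 <= u -> u <= v ->
  quad_var P (path_coord X k) u <= quad_var P (path_coord X k) v.
Proof.
move=> u0 uv; case: (qX k) => _ _ _ nd _.
by apply: nd => //; rewrite in_itv/= andbT// (le_trans u0).
Qed.

Let W_nd u v : 0 <= u -> u <= v -> W u <= W v.
Proof.
move=> u0 uv; apply: lerD.
  by apply: ler_sum => k _; exact: (controls_nd (tot_var_controls (hA k))).
by rewrite ler_wpM2l ?ler0n//; apply: ler_sum => k _; exact: quad_nd.
Qed.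

Let weight_jump r s : 0 <= r -> r < s ->
  weight (A s - left_lim A s) (X s - left_lim X s) <= W s - W r.
Proof.
move=> r0 rs; have s0 : 0 < s by exact: le_lt_trans rs.
rewrite /W opprD addrACA; apply: lerD.
  rewrite -sumrB; apply: ler_sum => k _; rewrite -jump_coord//.
  by apply: jump_controls => //; [exact: tot_var_controls | case: (hA k)].
apply: (le_trans (sqr_norm1_le _)); rewrite -mulrBr ler_wpM2l ?ler0n// -sumrB.
apply: ler_sum => k _; rewrite -jump_coord//.
have [_ _ cq nd jq] := qX k.
rewrite -(jq s (ltW s0)) (le_trans (ler_norm _))//; apply: jump_controls => //.
move=> x y x0 xy; rewrite ger0_norm ?subr_ge0//; exact: quad_nd.
Qed.

(** The path stays on [u, w[ in a ball where the Taylor remainder is at most e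
    times the weight. *)
Let good (e u w : R) := exists a0 x0 r, [/\
  forall a x a' x', `|a - a0| <= r -> `|x - x0| <= r ->
    `|a' - a0| <= r -> `|x' - x0| <= r ->
    `|taylor_rem f a x a' x'| <= e * weight (a' - a) (x' - x),
  forall s, u <= s -> s < w -> `|A s - a0| <= r &
  forall s, u <= s -> s < w -> `|X s - x0| <= r].

Let good_left e v : 0 < e -> 0 < v -> \forall u \near v^'-, good e u v.
Proof.
move=> e0 v0; have [r r0 rP] := taylor_rem_local hf (left_lim A v) (left_lim X v) e0.
apply: filterS2 (cadlag_near_left cA v0 (nbhs_dist_le _ r0))
  (cadlag_near_left cX v0 (nbhs_dist_le _ r0)) => u HA HX.
by exists (left_lim A v), (left_lim X v), r.
Qed.

Let good_right e v : 0 < e -> 0 <= v -> \forall w \near v^'+, good e v w.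
Proof.
move=> e0 v0; have [r r0 rP] := taylor_rem_local hf (A v) (X v) e0.
apply: filterS2 (cadlag_near_right cA v0 (nbhs_dist_le _ r0))
  (cadlag_near_right cX v0 (nbhs_dist_le _ r0)) => u HA HX.
by exists (A v), (X v), r.
Qed.

Let good_jump e u w s : good e u w -> 0 <= u -> u < s -> s < w ->
  `|jumpR s| <= e * weight (A s - left_lim A s) (X s - left_lim X s).
Proof.
move=> [a0 [x0 [r [rP HA HX]]]] u0 us sw; apply: rP.
- exact: (left_lim_dist_le cA u0 HA us (ltW sw)).
- exact: (left_lim_dist_le cX u0 HX us (ltW sw)).
- by apply: HA => //; exact: ltW.
- by apply: HX => //; exact: ltW.
Qed.

Let esum_weight e u w : 0 < e -> 0 <= u -> u <= w ->
  (\esum_(s in `]u, w[) (e * weight (A s - left_lim A s) (X s - left_lim X s))%:E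
    <= (e * (W w - W u))%:E)%E.
Proof.
move=> e0 u0 uw.
apply: (@le_trans _ _
  (\esum_(s in `]u, w]) (e * weight (A s - left_lim A s) (X s - left_lim X s))%:E)%E).
  rewrite [leRHS](esumID `]u, w[%classic); last first.
    by move=> s _; rewrite lee_fin mulr_ge0 ?weight_ge0// ltW.
  rewrite (_ : _ `&` `]u, w[%classic = `]u, w[%classic); last first.
    by apply/setIidr => s; rewrite /= !in_itv/= => /andP[-> /ltW ->].
  rewrite leeDl// esum_ge0// => s _.
  by rewrite lee_fin mulr_ge0 ?weight_ge0// ltW.
rewrite mulrBr; apply: (@esum_jump_le _ (fun s => e * W s)
  (fun s => e * weight (A s - left_lim A s) (X s - left_lim X s))) => //.
- by move=> x y x0 xy; rewrite ler_pM2l// W_nd.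
- by move=> x y x0 xy; rewrite -mulrBr ler_pM2l// weight_jump.
Qed.

Let itvoc_split (u w : R) : u < w -> `]u, w]%classic = `]u, w[%classic `|` [set w] :> set R.
Proof. by move=> uw; rewrite setUitv1. Qed.

Let itvoo_disj (u w : R) : `]u, w[%classic `&` [set w] = set0 :> set R.
Proof.
by apply/seteqP; split => // x [/= + xw]; rewrite xw in_itv/= ltxx andbF.
Qed.

Let good_summable e u w : 0 < e -> good e u w -> 0 <= u -> u < w ->
  summable `]u, w] (EFin \o jumpR).
Proof.
move=> e0 G u0 uw; rewrite itvoc_split//; apply: (summable_setU (itvoo_disj _ _)).
  apply: (@summable_esum_le _ _ _ (e * (W w - W u))).
  apply: (le_trans _ (esum_weight e0 u0 (ltW uw))); apply: le_esum => s.
  by rewrite /= in_itv/= => /andP[us sw]; rewrite lee_fin (good_jump G).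
exact: summable_set1.
Qed.

(** On a good interval the remainders of the jumps are dominated by summable
    weights, except at the right end point; good intervals cover [0, t] by
    compactness. *)
Lemma summable_jump_rem t : 0 <= t -> summable `]0, t] (EFin \o jumpR).
Proof.
move=> t0; apply: (@cousin_additive _ (fun u v => summable `]u, v] (EFin \o jumpR))) => //.
- by move=> u v w _ uv vw _; exact: summable_itvU.
- move=> v _ _; rewrite set_itvoc0.
  by apply: (@summable_esum_le _ _ _ 0); rewrite esum_set0.
- move=> v v0 vt; near=> u; apply: (@good_summable 1) => //.
  + by near: u; exact: good_left.
  + by apply/ltW; near: u; exact: nbhs_left_gt.
- move=> v v0 vt; near=> w; apply: (@good_summable 1) => //.
  by near: w; exact: good_right.
Unshelve. all: by end_near. Qed.

Section fixed_time.
Variable t : R.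
Hypothesis t0 : 0 <= t.

Let rem n i := taylor_rem f (A (P n i)) (X (P n i))
  (A (Num.min (P n i.+1) t)) (X (Num.min (P n i.+1) t)).

Let b n i := \sum_(k < m) incr (P n) t (tot_var (path_coord A k)) i +
  d%:R * \sum_(k < d) incr (P n) t (path_coord X k) i ^+ 2.

Let b_ge0 n i : 0 <= b n i.
Proof.
apply: addr_ge0.
  apply: sumr_ge0 => k _.
  exact: le_trans (incr_controls (P n) i (tot_var_controls (hA k)) t0).
by rewrite mulr_ge0// sumr_ge0// => k _; exact: sqr_ge0.
Qed.

Let weight_incr n i : P n i <= t ->
  weight (A (Num.min (P n i.+1) t) - A (P n i)) (X (Num.min (P n i.+1) t) - X (P n i)) <= b n i.
Proof.
move=> it; apply: lerD.
  apply: ler_sum => k _; rewrite !mxE.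
  have := incr_controls (P n) i (tot_var_controls (hA k)) t0.
  by rewrite {1}/incr /path_coord (min_l it).
apply: (le_trans (sqr_norm1_le _)); rewrite ler_wpM2l ?ler0n//.
by apply: ler_sum => k _; rewrite !mxE /incr /path_coord (min_l it).
Qed.

Let sum_b_bounded : exists C, \forall n \near \oo, \sum_(0 <= i < hit_index (P n) t) b n i <= C.
Proof.
have [<-|tn0] := eqVneq 0 t.
  by exists 0; apply: nearW => n; rewrite hit_index0 big_geq.
have tpos : 0 < t by rewrite lt_neqAle tn0.
exists (\sum_(k < m) (tot_var (path_coord A k) t - tot_var (path_coord A k) 0) +
  d%:R * (\sum_(k < d) quad_var P (path_coord X k) t + 1)).
have cq : \sum_(k < d) \sum_(0 <= i < hit_index (P n) t) incr (P n) t (path_coord X k) i ^+ 2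
    @[n --> \oo] --> \sum_(k < d) quad_var P (path_coord X k) t.
  by apply: cvg_sumr => k; exact: quad_sum_cvg.
near=> n; rewrite big_split/=; apply: lerD.
  rewrite exchange_big; apply: ler_sum => k _; rewrite sum_incr// lerD2r.
  have := tot_var_controls (hA k) => /controls_nd; apply.
    by rewrite le_min time_ge0.
  by rewrite ge_min lexx orbT.
rewrite -mulr_sumr ler_wpM2l ?ler0n// exchange_big/=.
by near: n; move/cvgr_le : cq; apply; rewrite ltrDl.
Unshelve. all: by end_near. Qed.

(** The cell of w shrinks to w with its left end strictly before w. *)
Let last_rem_cvg w : 0 < w -> w <= t -> rem n (hit_index (P n) w).-1 @[n --> \oo] --> jumpR w.
Proof.
move=> w0 wt; apply: cvg_taylor_rem => //.
- exact: left_cell_cvg.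
- exact: left_cell_cvg.
- by under eq_fun do rewrite hit_index_prednK//; exact: right_cell_cvg.
- by under eq_fun do rewrite hit_index_prednK//; exact: right_cell_cvg.
Qed.

(** On a good interval [u, w[ all cells but the last, and all jumps but the
    one at w, have remainders of at most e times their weights, while the last
    cell matches the jump at w. [additive_limit] concludes. *)
Lemma sum_rem_cvg :
  \sum_(0 <= i < hit_index (P n) t) rem n i @[n --> \oo] --> unordered_sum `]0, t] jumpR.
Proof.
pose S n v := \sum_(0 <= i < hit_index (P n) v) rem n i.
pose B n v := \sum_(0 <= i < hit_index (P n) v) b n i + W v.
pose I v := unordered_sum `]0, v] jumpR.
have I0 : I 0 = 0.
  rewrite /I set_itvoc0 -(unordered_sum0 (set0 : set R)).
  exact: eq_unordered_sum.
have S0 n : S n 0 = 0 by rewrite /S hit_index0 big_geq.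
suff : S n t - S n 0 @[n --> \oo] --> I t - I 0.
  by rewrite I0 subr0; under eq_fun do rewrite S0 subr0.
have [C bC] := sum_b_bounded.
apply: (@additive_limit _ S B I (C + W t - W 0)) => //.
  apply: filterS bC => n bC.
  by rewrite /B hit_index0 [X in _ - (X + _)]big_geq//; lra.
move=> e e0; exists (good e); last first.
  by split => [v v0 _|v v0 _]; [exact: good_left|exact: good_right].
move=> u w u0 uw wt G eta eta0.
have w0 : 0 < w by exact: le_lt_trans uw.
have IE : I w - I u = unordered_sum `]u, w[ jumpR + jumpR w.
  rewrite /I (unordered_sum_itvU u0 (ltW uw) (summable_jump_rem (ltW w0))) addrAC subrr add0r.
  have := good_summable e0 G u0 uw; rewrite itvoc_split// => sG.
  by rewrite (unordered_sum_setU (itvoo_disj _ _) sG) unordered_sum_set1.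
have Iest : `|unordered_sum `]u, w[ jumpR| <= e * (W w - W u).
  apply: (unordered_sum_le _ (esum_weight e0 u0 (ltW uw))) => s.
  by rewrite /= in_itv/= => /andP[us sw]; exact: good_jump G u0 us sw.
have left_of_last : \forall n \near \oo, u <= P n (hit_index (P n) w).-1.
  have uw_near : \forall s \near w^'-, u <= s.
    by near=> s; apply/ltW; near: s; exact: nbhs_left_gt.
  exact: (time_pred_hit_index_cvg hP w0 uw_near).
have last_close : \forall n \near \oo, `|jumpR w - rem n (hit_index (P n) w).-1| <= eta.
  by have /cvgrPdist_le/(_ _ eta0) := last_rem_cvg w0 wt.
near=> n.
pose j := (hit_index (P n) w).-1.
have uj : u <= P n j by rewrite /j; near: n.
have last_small : `|jumpR w - rem n j| <= eta by rewrite /j; near: n.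
have hj : (hit_index (P n) u <= j)%N by rewrite leqNgt -hit_indexP -leNgt.
have jw : P n j < w by exact: time_pred_hit_index.
have SE : S n w - S n u = \sum_(hit_index (P n) u <= i < j) rem n i + rem n j.
  rewrite /S (big_cat_nat (leq0n _) (le_hit_index (P n) (ltW uw)))/= addrAC subrr add0r.
  by rewrite -(hit_index_prednK (P n) w0) big_nat_recr.
have BE : B n w - B n u = \sum_(hit_index (P n) u <= i < j) b n i + b n j + (W w - W u).
  rewrite /B (big_cat_nat (leq0n _) (le_hit_index (P n) (ltW uw)))/=.
  by rewrite -(hit_index_prednK (P n) w0) big_nat_recr//=; ring.
have sum_est : `|\sum_(hit_index (P n) u <= i < j) rem n i| <=
    e * \sum_(hit_index (P n) u <= i < j) b n i.
  rewrite (le_trans (ler_norm_sum _ _ _))// mulr_sumr.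
  rewrite big_nat_cond [leRHS]big_nat_cond; apply: ler_sum => i /andP[/andP[ui ij] _].
  have Pui : u <= P n i by rewrite leNgt hit_indexP -leqNgt.
  have PSw : P n i.+1 < w by rewrite (le_lt_trans _ jw)// time_le.
  have PiS : P n i < P n i.+1 by exact: time_lt.
  have Pit : P n i <= t by rewrite (le_trans (ltW PiS))// (le_trans (ltW PSw)).
  apply: (@le_trans _ _ (e * weight (A (Num.min (P n i.+1) t) - A (P n i))
      (X (Num.min (P n i.+1) t) - X (P n i)))); last by rewrite ler_pM2l// weight_incr.
  rewrite /rem (min_l (le_trans (ltW PSw) wt)).
  have [a0 [x0 [r [rP HA HX]]]] := G.
  apply: rP; [apply: HA|apply: HX|apply: HA|apply: HX] => //.
  - exact: lt_trans PSw.
  - exact: lt_trans PSw.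
  - exact: le_trans (ltW PiS).
  - exact: le_trans (ltW PiS).
rewrite SE IE BE.
set s2 := \sum_(_ <= i < _) _; set s1 := \sum_(_ <= i < _) _; set s3 := unordered_sum _ _.
rewrite (_ : _ - _ = s1 - s3 - (jumpR w - rem n j)); last by ring.
have b0 : 0 <= e * b n j by rewrite mulr_ge0 ?b_ge0// ltW.
have := ler_normB (s1 - s3) (jumpR w - rem n j); have := ler_normB s1 s3.
move: sum_est Iest last_small b0; rewrite -/s1 -/s2 -/s3.
move: (W w - W u) (b n j) => dW bj; rewrite !mulrDr.
move: `|_ - _ - _| `|_ - _| `|_ - _| `|s1| `|s3| (e * s2) (e * dW) (e * bj) => *.
lra.
Unshelve. all: by end_near. Qed.

End fixed_time.
End ito.

(** * The change of variables formula *)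

Theorem theorem2p13 (R : realType) (m d : nat)
    (P : nat -> time_partition R) (hP : mesh_vanishes P)
    (X : R -> 'rV[R]_d) (hX : QV P X)
    (A : R -> 'rV[R]_m) (hA : forall k : 'I_m, FV_loc (path_coord A k))
    (f : 'rV[R]_m -> 'rV[R]_d -> R) (hf : C12 f)
    (t : R) (ht : 0 <= t) :
  let Am := left_lim A in
  let Xm := left_lim X in
  let xi := fun s => grad_x f (A s) (X s) in
  let jump_term := fun s =>
    (f (A s) (X s) - f (Am s) (Xm s)) -
    \sum_(k < d) partial_x f k (Am s) (Xm s) * jump (path_coord X k) s in
  [/\ if_int_exists P xi X t,
      forall k : 'I_m, fv_integrable (cont_part (path_coord A k))
        (fun s => partial_a f k (Am s) (Xm s)) t,
      forall k l : 'I_d,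
        fv_integrable (cont_part (covar P (path_coord X k) (path_coord X l)))
          (fun s => partial_xx f k l (Am s) (Xm s)) t,
      summable `]0, t] (EFin \o jump_term) &
      f (A t) (X t) - f (A 0) (X 0) =
        \sum_(k < m) fv_int (cont_part (path_coord A k))
          (fun s => partial_a f k (Am s) (Xm s)) t
        + if_int P xi X t
        + 2^-1 * \sum_(k < d) \sum_(l < d)
            fv_int (cont_part (covar P (path_coord X k) (path_coord X l)))
              (fun s => partial_xx f k l (Am s) (Xm s)) t
        + unordered_sum `]0, t] jump_term].
Proof.
move=> Am Xm xi jump_term.
have cX : cadlag X := hX.1.
have cA : cadlag A by apply: cadlag_row => k; case: (hA k).
have [_ [ja jx jxx]] := hf.
have qX k : has_quad_var P (path_coord X k).
  by apply: has_quad_var_half; [exact: cadlag_coord|exact: hX.2].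
have cov_FV k l : FV_loc (covar P (path_coord X k) (path_coord X l)).
  by apply: covar_FV => //; exact: hX.2.
have ca k := cadlag_jointly (ja k) cA cX.
have cxx k l := cadlag_jointly (jxx k l) cA cX.
have la k := left_lim_jointly (ja k) cA cX.
have lxx k l := left_lim_jointly (jxx k l) cA cX.
pose jR s := taylor_rem f (left_lim A s) (left_lim X s) (A s) (X s).
pose ua k s := partial_a f k (Am s) (Xm s) * jump (path_coord A k) s.
pose uxx k l s := partial_xx f k l (Am s) (Xm s) *
  (jump (path_coord X k) s * jump (path_coord X l) s).
have sR : summable `]0, t] (EFin \o jR) by exact: (summable_jump_rem hX hA hf ht).
have sa k : summable `]0, t] (EFin \o ua k).
  by have := summable_left_lim_jump (hA k) (ca k) ht; rewrite la.
have sxx k l : summable `]0, t] (EFin \o uxx k l).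
  apply: (@summable_le _ _ _ (fun s => `|partial_xx f k l (Am s) (Xm s) *
      jump (covar P (path_coord X k) (path_coord X l)) s|)).
    move=> s; rewrite /= in_itv/= => /andP[s0 _].
    by rewrite /uxx jump_covar//; exact: hX.2.
  have := summable_left_lim_jump (cov_FV k l) (cxx k l) ht; rewrite lxx.
  by rewrite /summable/=; under eq_esum do rewrite -[`|_ * _|]normr_id.
(* The Taylor terms of a jump other than the one in X are exactly the jump
   sums that come with the limits of the Riemann sums below. *)
have jumpE : jump_term = (fun s => jR s +
    (\sum_k ua k s + 2^-1 * \sum_k \sum_l uxx k l s)).
  apply/funext => s; rewrite /jump_term /jR /taylor_rem /taylor_part.
  under [X in _ = _ - (X + _ + _) + _]eq_bigr do rewrite -jump_coord//.
  under [X in _ = _ - (_ + X + _) + _]eq_bigr do rewrite -jump_coord//.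
  under [X in _ = _ - (_ + _ + _ * X) + _]eq_bigr => k _.
    under eq_bigr do rewrite -!jump_coord//.
    over.
  by rewrite /=; ring.
have sjump_aux : summable `]0, t] (EFin \o (fun s => \sum_k ua k s)).
  exact: summable_real_sum.
have sjump_auxx : summable `]0, t] (EFin \o (fun s => \sum_k \sum_l uxx k l s)).
  by apply: summable_real_sum => k; exact: summable_real_sum.
have usum_jump : unordered_sum `]0, t] jump_term = unordered_sum `]0, t] jR +
    (\sum_k unordered_sum `]0, t] (ua k) +
     2^-1 * \sum_k \sum_l unordered_sum `]0, t] (uxx k l)).
  have sxxZ := summable_realZ 2^-1 sjump_auxx.
  rewrite jumpE (unordered_sumD sR (summable_realD sjump_aux sxxZ)).
  rewrite (unordered_sumD sjump_aux sxxZ) (unordered_sumZ _ sjump_auxx).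
  rewrite (unordered_sum_sum _ sa).
  rewrite (unordered_sum_sum _ (fun k => summable_real_sum _ (sxx k))).
  congr (_ + (_ + _ * _)); apply: eq_bigr => k _.
  by rewrite (unordered_sum_sum _ (sxx k)).
pose Ia k := fv_int (cont_part (path_coord A k)) (fun s => partial_a f k (Am s) (Xm s)) t.
pose Ixx k l := fv_int (cont_part (covar P (path_coord X k) (path_coord X l)))
              (fun s => partial_xx f k l (Am s) (Xm s)) t.
pose L := f (A t) (X t) - f (A 0) (X 0) -
  (\sum_k (Ia k + unordered_sum `]0, t] (ua k)) +
   2^-1 * \sum_k \sum_l (Ixx k l + unordered_sum `]0, t] (uxx k l)) +
   unordered_sum `]0, t] jR).
pose Sa n k := \sum_(0 <= i < hit_index (P n) t)
  partial_a f k (A (P n i)) (X (P n i)) * incr (P n) t (path_coord A k) i.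
pose Sxx n k l := \sum_(0 <= i < hit_index (P n) t)
  partial_xx f k l (A (P n i)) (X (P n i)) *
    (incr (P n) t (path_coord X k) i * incr (P n) t (path_coord X l) i).
pose SR n := \sum_(0 <= i < hit_index (P n) t) taylor_rem f (A (P n i)) (X (P n i))
  (A (Num.min (P n i.+1) t)) (X (Num.min (P n i.+1) t)).
have Sa_cvg k : Sa n k @[n --> \oo] --> Ia k + unordered_sum `]0, t] (ua k).
  have := riemann_sum_path hP ht (hA k) (ca k).
  by rewrite la.
have Sxx_cvg k l : Sxx n k l @[n --> \oo] --> Ixx k l + unordered_sum `]0, t] (uxx k l).
  have := riemann_sum_covar hP (qX k) (qX l) (hX.2 k l) ht (cxx k l).
  by rewrite lxx.
have SR_cvg : SR n @[n --> \oo] --> unordered_sum `]0, t] jR.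
  exact: (sum_rem_cvg hP hX hA hf ht).
(* Taylor's formula on each cell: the sums that define the integral are the
   increment of f minus three sums with known limits. *)
have ifE n : if_sum P xi X t n = f (A t) (X t) - f (A 0) (X 0) -
    (\sum_k Sa n k + 2^-1 * \sum_k \sum_l Sxx n k l + SR n).
  rewrite /if_sum (@limn_series_hit _ (P n) t); last first.
    move=> i ti; rewrite !min_r//; last by rewrite (le_trans ti)// ltW// time_lt.
    by rewrite /dot big1// => k _; rewrite !mxE subrr mulr0.
  have tele : f (A t) (X t) - f (A 0) (X 0) =
      \sum_(0 <= i < hit_index (P n) t) incr (P n) t (fun s => f (A s) (X s)) i.
    by rewrite sum_incr// min_r// time_hit_index.
  rewrite tele /Sa /Sxx /SR [X in _ - (X + _ + _)]exchange_big/=.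
  under [X in _ * X]eq_bigr do rewrite exchange_big/=.
  rewrite [X in _ * X]exchange_big/= mulr_sumr -!big_split/= -sumrB.
  rewrite big_nat_cond [RHS]big_nat_cond; apply: eq_bigr => i /andP[/andP[_ it] _].
  have Pit : P n i <= t by rewrite ltW// hit_indexP.
  rewrite {1}/incr (min_l Pit) /taylor_rem /taylor_part.
  rewrite /dot /xi /grad_x.
  rewrite [LHS](_ : _ = \sum_(k < d) partial_x f k (A (P n i)) (X (P n i)) *
      (X (Num.min (P n i.+1) t) - X (P n i)) 0 k); last first.
    by apply: eq_bigr => k _; rewrite mxE.
  have Ea : \sum_(k < m) partial_a f k (A (P n i)) (X (P n i)) *
      (A (Num.min (P n i.+1) t) - A (P n i)) 0 k =
     \sum_(k < m) partial_a f k (A (P n i)) (X (P n i)) * incr (P n) t (path_coord A k) i.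
    by apply: eq_bigr => k _; rewrite !mxE /incr /path_coord (min_l Pit).
  have Exx : \sum_(k < d) \sum_(l < d) partial_xx f k l (A (P n i)) (X (P n i)) *
      ((X (Num.min (P n i.+1) t) - X (P n i)) 0 k * (X (Num.min (P n i.+1) t) - X (P n i)) 0 l) =
     \sum_(k < d) \sum_(l < d) partial_xx f k l (A (P n i)) (X (P n i)) *
       (incr (P n) t (path_coord X k) i * incr (P n) t (path_coord X l) i).
    apply: eq_bigr => k _; apply: eq_bigr => l _.
    by rewrite !mxE /incr /path_coord (min_l Pit).
  rewrite Ea Exx; ring.
have if_cvg : if_sum P xi X t n @[n --> \oo] --> L.
  rewrite (funext ifE); apply: cvgB; first exact: cvg_cst.
  apply: cvgD => //; apply: cvgD.
    by apply: cvg_sumr => k; exact: Sa_cvg.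
  apply: cvgMr; apply: cvg_sumr => k; apply: cvg_sumr => l; exact: Sxx_cvg.
split.
- by apply/cvg_ex; exists L.
- move=> k; rewrite -la.
  exact: (fv_integrable_left_lim hP (cont_part_FV (hA k)) (ca k) ht).
- move=> k l; rewrite -lxx.
  exact: (fv_integrable_left_lim hP (cont_part_FV (cov_FV k l)) (cxx k l) ht).
- rewrite jumpE; apply: summable_realD => //; apply: summable_realD => //.
  exact: summable_realZ.
- rewrite /if_int (cvg_lim _ if_cvg)// usum_jump /L -/Ia -/Ixx.
  have Ea : \sum_k (Ia k + unordered_sum `]0, t] (ua k)) =
      \sum_k Ia k + \sum_k unordered_sum `]0, t] (ua k) by exact: big_split.
  have Exx : \sum_k \sum_l (Ixx k l + unordered_sum `]0, t] (uxx k l)) =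
      \sum_k \sum_l Ixx k l + \sum_k \sum_l unordered_sum `]0, t] (uxx k l).
    by rewrite -big_split; apply: eq_bigr => k _; exact: big_split.
  rewrite Ea Exx.
  move: (\sum_k Ia k) (\sum_k unordered_sum _ _) (\sum_k \sum_l Ixx k l)
    (\sum_k \sum_l unordered_sum _ _) (unordered_sum _ _) (f (A t) (X t)) (f (A 0) (X 0)).
  by move=> *; ring.
Qed.
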